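(* Let $V$ be the vertex set of a finite connected graph, $n=|V|$, $p>4$, and let the potentials $a_0,b_0:V\to\mathbb R$ satisfy (A1): $a_0,b_0\ge V_0$ on $V$ for some constant $V_0>0$, and (A2'): there is $\mathcal M_0>0$ such that $\{a_0\le\mathcal M_0\}$, $\{b_0\le\mathcal M_0\}$ have finite volume, $1/a_0\in L^1(V\setminus\{a_0\le\mathcal M_0\})$ and $1/b_0\in L^1(V\setminus\{b_0\le\mathcal M_0\})$. Suppose that $(u_0,v_0)$ is a non-degenerate ground state of $J_{a_0,b_0}$ in the positive cone $\widetilde{\mathcal H}=\{(u,v)\in\mathcal H:u\ge0,\ v\ge0\}$, and let $a\mapsto(u_a,v_a)$ be the unique $C^1$ branch, defined for $a$ near $a_0$ with $b=b_0$ fixed, of ground states of $J_{a,b_0}$ with $(u_{a_0},v_{a_0})=(u_0,v_0)$, the entire branch lying in $\widetilde{\mathcal H}$. Define the branch energy $\mathcal E(a):=J_{a,b_0}(u_a,v_a)$. Then $\Phi:=-\mathcal E$ is twice differentiable at $a_0$ and its Hessian admits the exact factorisation $$D_a^2\Phi(a_0)=W\,\mathsf H_{\mathrm{eff}}\,W-\frac1{2M}(u_0^p)(u_0^p)^{\mathsf T},\qquad W=\operatorname{diag}(u_0^{p-1}),$$ where $\mathsf H_{\mathrm{eff}}$ is the effective matrix (an $n\times n$ symmetric positive definite matrix) obtained from the restriction of the full Hessian $J''_{a_0,b_0}(u_0,v_0)$ to the tangent space $T_{(u_0,v_0)}\mathcal N_{a_0,b_0}$ by the constrained Schur complement, $M=\int_V(|u_0|^{p-2}v_0^2+|v_0|^{p-2}u_0^2)\,d\mu>0$,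 and $(u_0^p)$ denotes the column vector $(u_0(x)^p)_{x\in V}$.
   Context: Notation. $\mu$ is the counting measure on $V$, $\int_Vf\,d\mu=\sum_{x\in V}f(x)$, and $|\nabla u|(x)=\big(\frac12\sum_{y\sim x}(u(y)-u(x))^2\big)^{1/2}$. As $V$ is finite, $\mathcal H=C(V)\times C(V)\cong\mathbb R^{n}\times\mathbb R^n$ ($C(V)$: real functions on $V$), with norm $\|(u,v)\|_{\mathcal H}=\|u\|_{\mathcal H_a}+\|v\|_{\mathcal H_b}$, $\|u\|_{\mathcal H_a}^p=\int_V(|\nabla u|^p+a|u|^p)d\mu$, $\|v\|_{\mathcal H_b}^p=\int_V(|\nabla v|^p+b|v|^p)d\mu$. With $s^2\log s^2:=0$ at $s=0$, $$J_{a,b}(u,v)=\tfrac1p\big(\|u\|_{\mathcal H_a}^p+\|v\|_{\mathcal H_b}^p\big)-\tfrac1p\int_V\big(|u|^{p-2}v^2\log v^2+|v|^{p-2}u^2\log u^2\big)d\mu.$$ $G_{a,b}(u,v)=J_{a,b}'(u,v)\cdot(u,v)$, $\mathcal N_{a,b}=\{(u,v)\in\mathcal H\setminus\{(0,0)\}:G_{a,b}(u,v)=0\}$, $d(a,b)=\inf_{\mathcal N_{a,b}}J_{a,b}$; a ground state of $J_{a,b}$ is a minimiser of $J_{a,b}$ on $\mathcal N_{a,b}$. Ground states in the positive cone are strictly positive at every vertex, and $J_{a,b}$ is $C^2$ near them. Tangent space: $T=T_{(u_0,v_0)}\mathcal N_{a_0,b_0}=\{(\phi,\psi)\in\mathcal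 H:\langle G_{a_0,b_0}'(u_0,v_0),(\phi,\psi)\rangle=0\}$, of dimension $m=2n-1$. The ground state $(u_0,v_0)$ is non-degenerate if $J''_{a_0,b_0}(u_0,v_0)$ restricted to $T$ is an isomorphism $T\to T^*$ (hence positive definite, the ground state being a minimum on the Nehari manifold). Effective matrix: choose an orthonormal basis $e_i=(\phi_i,\psi_i)$, $i=1,\dots,m$, of $T$ (for the Euclidean inner product on $\mathbb R^{2n}$); let $H_{\mathrm{mat}}\in\mathbb R^{m\times m}$, $(H_{\mathrm{mat}})_{ij}=\langle J''_{a_0,b_0}(u_0,v_0)e_j,e_i\rangle$, and let $U\in\mathbb R^{n\times m}$, $U_{xi}=\phi_i(x)$. Then $\mathsf H_{\mathrm{eff}}:=U H_{\mathrm{mat}}^{-1}U^{\mathsf T}\in\mathbb R^{n\times n}$. *)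

(* Defs.v *)
From HB Require Import structures.
From mathcomp Require Import all_boot all_order all_algebra.
From mathcomp Require Import all_classical all_reals all_analysis.

Set Implicit Arguments.
Unset Strict Implicit.
Unset Printing Implicit Defensive.

Import Order.TTheory GRing.Theory Num.Theory.
Import numFieldNormedType.Exports.

Local Open Scope classical_set_scope.
Local Open Scope ring_scope.

Definition connected_graph (V : finType) (e : rel V) : Prop :=
  [/\ symmetric e, irreflexive e & forall x y : V, connect e x y].

(* C(V), the real functions on V, as column vectors: coordinate [k] is the
   value at the vertex [enum_val k]. *)
Notation fct R V := 'cV[R]_#|V|.
(* The space C(V) x C(V).  All norms on it are equivalent, so the library's
   product norm gives the same differentiability notions as ||.||_H. *)
Notation fct2 R V := (fct R V * fct R V)%type.

Definition at_vertex (R : realType) (V : finType) (u : fct R V) (x : V) : R :=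
  u (enum_rank x) ord0.

Section Functionals.
Context (R : realType) (V : finType) (e : rel V) (p : R).
Implicit Types (a b u v : fct R V) (w h k : fct2 R V).

Local Notation "u ! x" := (at_vertex u x) (at level 2, right associativity).

Definition grad_norm u (x : V) : R :=
  Num.sqrt (2^-1 * \sum_(y : V | e x y) (u ! y - u ! x) ^+ 2).

(* ||u||_{H_a}^p *)
Definition normHp a u : R :=
  \sum_(x : V) (grad_norm u x `^ p + a ! x * `|u ! x| `^ p).

Definition xlogx (t : R) : R := if t == 0 then 0 else t * ln t.

Definition J a b w : R :=
  p^-1 * (normHp a w.1 + normHp b w.2)
  - p^-1 * \sum_(x : V)
      (`|w.1 ! x| `^ (p - 2) * xlogx ((w.2 ! x) ^+ 2)
       + `|w.2 ! x| `^ (p - 2) * xlogx ((w.1 ! x) ^+ 2)).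

Definition G a b w : R := 'd (J a b) w w.

Definition nehari a b : set (fct2 R V) :=
  [set w | w <> (0, 0) /\ G a b w = 0].

Definition ground_state a b w : Prop :=
  nehari a b w /\ (forall w', nehari a b w' -> J a b w <= J a b w').

Definition tangent a b w : set (fct2 R V) := [set h | 'd (G a b) w h = 0].

(* <J''_{a,b}(w) h, k> *)
Definition d2J a b w h k : R := 'd (fun z => 'd (J a b) z k) w h.

(* h |-> <J''(w) h, .> is an isomorphism T -> T^*: every linear form on T has
   exactly one preimage in T.  Every linear form on the subspace T is the
   restriction of one on the whole space. *)
Definition nondegenerate_on_tangent a b w : Prop :=
  forall l : {scalar (fct2 R V)},
    exists! h, tangent a b w h /\
      (forall k, tangent a b w k -> d2J a b w h k = l k).

Definition dotH h k : R :=
  \sum_(x : V) h.1 ! x * k.1 ! x + \sum_(x : V) h.2 ! x * k.2 ! x.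

Definition orthonormal_basis (T : set (fct2 R V)) m (f : 'I_m -> fct2 R V) :
    Prop :=
  [/\ forall i, T (f i),
      forall i j, dotH (f i) (f j) = (i == j)%:R
    & forall h, T h -> exists c : 'I_m -> R, h = \sum_i c i *: f i].

Definition Hmat a b w m (f : 'I_m -> fct2 R V) : 'M[R]_m :=
  \matrix_(i, j) d2J a b w (f j) (f i).

Definition Umat m (f : 'I_m -> fct2 R V) : 'M[R]_(#|V|, m) :=
  \matrix_(k, i) (f i).1 k ord0.

Definition Heff a b w m (f : 'I_m -> fct2 R V) : 'M[R]_#|V| :=
  Umat f *m invmx (Hmat a b w f) *m (Umat f)^T.

Definition mass w : R :=
  \sum_(x : V) (`|w.1 ! x| `^ (p - 2) * (w.2 ! x) ^+ 2
                + `|w.2 ! x| `^ (p - 2) * (w.1 ! x) ^+ 2).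

Definition positive_cone : set (fct2 R V) :=
  [set w | forall x : V, 0 <= w.1 ! x /\ 0 <= w.2 ! x].

Definition assumption_A1 a b : Prop :=
  exists2 V0 : R, 0 < V0 & forall x : V, V0 <= a ! x /\ V0 <= b ! x.

(* Since the measure is the counting measure, L^1 is [summable]. *)
Definition assumption_A2' a b : Prop :=
  exists2 M0 : R, 0 < M0 &
    [/\ ((counting [set x | (a ! x <= M0)%R] : \bar R) < +oo)%E,
        ((counting [set x | (b ! x <= M0)%R] : \bar R) < +oo)%E,
        summable (~` [set x : V | a ! x <= M0]) (fun x => ((a ! x)^-1)%:E)
      & summable (~` [set x : V | b ! x <= M0]) (fun x => ((b ! x)^-1)%:E)].

(* A C^1 branch, over the open set [O] of potentials, of ground states lying
   in the positive cone, the second potential being fixed; the values of [w]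
   outside [O] are irrelevant. *)
Definition ground_state_branch (O : set (fct R V)) b
    (w : fct R V -> fct2 R V) : Prop :=
  [/\ forall a, O a -> differentiable w a,
      forall a, O a -> forall h : fct R V,
        {for a, continuous (fun a' => 'd w a' h)}
    & forall a, O a -> ground_state a b (w a) /\ positive_cone (w a)].

End Functionals.

Section SecondOrder.
Context (R : realType).

Definition gradient n (f : 'cV[R]_n -> R) (a : 'cV[R]_n) : 'cV[R]_n :=
  \col_i 'D_(delta_mx i ord0) f a.

Definition twice_differentiable n (f : 'cV[R]_n -> R) (a : 'cV[R]_n) : Prop :=
  (\forall a' \near a, differentiable f a') /\ differentiable (gradient f) a.

Definition hessian n (f : 'cV[R]_n -> R) (a : 'cV[R]_n) : 'M[R]_n :=
  \matrix_(i, j) ('D_(delta_mx j ord0) (gradient f) a) i ord0.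

Definition sym_posdef n (A : 'M[R]_n) : Prop :=
  A^T = A /\ (forall z : 'cV[R]_n, z != 0 -> 0 < (z^T *m A *m z) ord0 ord0).

Definition powcol n (u : 'cV[R]_n) (r : R) : 'cV[R]_n := \col_i (u i ord0 `^ r).

End SecondOrder.

(* Main.v *)
Require Import Defs.
From HB Require Import structures.
From mathcomp Require Import all_boot all_order all_algebra.
From mathcomp Require Import all_classical all_reals all_analysis.
From mathcomp Require Import ring lra.

Set Implicit Arguments.
Unset Strict Implicit.
Unset Printing Implicit Defensive.

Import Order.TTheory GRing.Theory Num.Theory.
Import numFieldNormedType.Exports.

Local Open Scope classical_set_scope.
Local Open Scope ring_scope.

(* J is homogeneous of degree p up to a logarithm,
     J (t w) = t^p (J w - (ln t^2 / p) mass w),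
   so G = p J - (2/p) mass everywhere, and scaling a point onto the Nehari set
   shows that a ground state w0 satisfies, wherever mass > 0,
     0 <= J w - J w0 + C (mass w - mass w0)^2.
   The penalty vanishes to second order at w0 and to fourth order along
   T = ker (mass' w0): hence J' w0 = 0, w0 > 0 (by propagating zeros along
   edges), and J'' w0 >= 0 on T.  Since J depends on the potential only through
   (1/p) sum_x a(x) |u(x)|^p, criticality gives grad Phi (a) = - u_a^p / p near
   a0, and it remains to compute the derivative of the branch: differentiating
   J' (w a) = 0 gives its component in T, through the inverse of the Hessian on
   T, and its component along w0, because J'' (w0, .) = - (2/p) mass'. *)

Local Notation "u \@ x" := (at_vertex u x)
  (at level 2, right associativity, format "u \@ x").

(** * Powers and logarithms of one variable *)

Section OneVariable.
Context (R : realType).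
Implicit Types (r s t : R).

Lemma cvg_is_derive (W : normedModType R) (f : R -> W) t (l : W) :
  h^-1 *: (f (h + t) - f t) @[h --> 0^'] --> l -> is_derive t 1 f l.
Proof.
move=> fl.
have E : (fun h : R => h^-1 *: ((f \o shift t) (h *: 1) - f t)) =
         (fun h : R => h^-1 *: (f (h + t) - f t)).
  by apply/funext => h /=; rewrite [h *: 1]mulr1.
split; first by rewrite /derivable E; apply/cvg_ex; exists l.
by rewrite /derive E; exact/cvg_lim.
Qed.

Lemma norm_powR_cvg0 s : 0 < s -> `|t| `^ s @[t --> (0 : R)] --> (0 : R).
Proof.
move=> s0; apply/cvgrPdist_lt => eps eps0; near=> t.
rewrite sub0r normrN ger0_norm ?powR_ge0//.
have -> : eps = (eps `^ s^-1) `^ s.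
  by rewrite -powRrM mulVf ?gt_eqF// powRr1// ltW.
apply: gt0_ltr_powR; rewrite ?nnegrE ?powR_ge0//.
near: t; apply: (@nbhs0_lt _ R); exact: powR_gt0.
Unshelve. all: by end_near. Qed.

(** The difference quotient at 0 is bounded by [C * |t| ^ (r - 1)], which tends to 0. This settles
    the origin, where the usual rules for powers and logarithms break down. *)
Lemma is_derive0_small (f : R -> R) (C r : R) : 1 < r -> f 0 = 0 ->
  (\forall t \near (0 : R), `|f t| <= C * `|t| `^ r) -> is_derive (0 : R) 1 f 0.
Proof.
move=> r1 f0 fC; apply: cvg_is_derive.
rewrite f0; under eq_fun do rewrite addr0 subr0.
have C0 : (C * `|t| `^ (r - 1)) @[t --> (0 : R)^'] --> C * 0.
  apply: cvgMr; apply: cvg_within_filter; apply: norm_powR_cvg0.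
  by rewrite subr_gt0.
rewrite mulr0 in C0.
apply: norm_cvg0; apply: (squeeze_cvgr _ (cvg_cst _) C0).
near=> t.
have t0 : t != 0 by near: t; exact: nbhs_dnbhs_neq.
have nt0 : 0 < `|t| by rewrite normr_gt0.
have ft : `|f t| <= C * `|t| `^ r by near: t; exact: nbhs_dnbhs.
rewrite normr_ge0/= normrZ normfV ler_pdivrMl// (le_trans ft)//.
by rewrite mulrCA mulr_powRB1// (lt_trans ltr01).
Unshelve. all: by end_near. Qed.

(** The odd counterpart of [|t| ^ r]: up to constants and a shift of the exponent, each of the two
    is the derivative of the other. *)
Definition spowR r t : R := Num.sg t * `|t| `^ r.

Lemma is_derive_powR_norm r t : 1 < r ->
  is_derive t 1 (fun t : R => `|t| `^ r) (r * spowR (r - 1) t).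
Proof.
move=> r1; rewrite /spowR.
have [t0|t0|->] := ltgtP t 0.
- rewrite ltr0_sg// ltr0_norm//.
  have E : \forall z \near t, (fun t => (- t) `^ r) z = `|z| `^ r.
    by near=> z; rewrite ltr0_norm//; near: z; exact: lt_nbhsl.
  apply: (near_eq_is_derive E).
  have t1 : 0 < - t by rewrite oppr_gt0.
  have := @is_derive1_comp R (fun x => x `^ r) -%R t _ _
            (is_derive1_powR r t1) (is_deriveNid t 1).
  by move/is_derive_eq; apply; ring.
- rewrite gtr0_sg// gtr0_norm// mul1r.
  have E : \forall z \near t, (fun t => t `^ r) z = `|z| `^ r.
    by near=> z; rewrite gtr0_norm//; near: z; exact: lt_nbhsr.
  apply: (near_eq_is_derive E).
  exact: is_derive1_powR.
- rewrite sgr0 mul0r mulr0.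
  apply: (@is_derive0_small _ 1 r) => //.
    by rewrite normr0 powR0// gt_eqF// (lt_trans ltr01).
  by near=> z; rewrite mul1r ger0_norm ?powR_ge0.
Unshelve. all: by end_near. Qed.

Lemma is_derive_spowR r t : 1 < r ->
  is_derive t 1 (spowR r) (r * `|t| `^ (r - 1)).
Proof.
move=> r1; rewrite /spowR.
have [t0|t0|->] := ltgtP t 0.
- have E : \forall z \near t, (fun t => - `|t| `^ r) z = spowR r z.
    near=> z; rewrite /spowR ltr0_sg ?mulN1r//; near: z; exact: lt_nbhsl.
  apply: (near_eq_is_derive E).
  apply: is_derive_eq (is_deriveN (is_derive_powR_norm t r1)) _.
  by rewrite /spowR ltr0_sg// mulN1r mulrN opprK.
- have E : \forall z \near t, (fun t : R => `|t| `^ r) z = spowR r z.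
    near=> z; rewrite /spowR gtr0_sg ?mul1r//; near: z; exact: lt_nbhsr.
  apply: (near_eq_is_derive E).
  apply: is_derive_eq (is_derive_powR_norm t r1) _.
  by rewrite /spowR gtr0_sg// mul1r.
- rewrite normr0 powR0 ?subr_eq0 ?gt_eqF// mulr0.
  apply: (@is_derive0_small _ 1 r) => //; first by rewrite sgr0 mul0r.
  near=> z; rewrite mul1r normrM normr_sg ger0_norm ?powR_ge0//.
  by case: (z != 0); rewrite ?mul1r ?mul0r ?powR_ge0.
Unshelve. all: by end_near. Qed.

(** With [|t| = y ^+ 2] the left side is [4 y^4 |ln y|], and [- ln y < 1 / y]. The exponent [3/2]
    exceeds 1, as [is_derive0_small] demands. *)
Lemma ln_sqr_bound t : t != 0 -> `|t| < 1 ->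
  `|t ^+ 2 * ln (t ^+ 2)| <= 4 * `|t| `^ (3/2).
Proof.
move=> t0 t1; have nt : 0 < `|t| by rewrite normr_gt0.
rewrite -(real_normK (num_real t)); set x := `|t| in t1 nt *.
set y := x `^ (2^-1).
have y0 : 0 < y by exact: powR_gt0.
have xy : x = y ^+ 2.
  by rewrite -powR_mulrn ?ltW// -powRrM mulVf ?powRr1// ltW.
have -> : x `^ (3/2) = y ^+ 3.
  by rewrite -powR_mulrn ?(ltW y0)// -powRrM mulrC.
rewrite normrM ger0_norm ?sqr_ge0// xy -exprM lnXn// -[(2 * 2)%N]/4%N.
have y1 : y < 1.
  rewrite ltNge; apply/negP => y1; move: t1; rewrite ltNge xy => /negP; apply.
  by rewrite expr_ge1// ltW.
have ly : `|ln y| <= y^-1.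
  rewrite ltr0_norm ?ln_lt0 ?y0// -lnV ?posrE//.
  by rewrite ltW// ln_sublinear// invr_gt0.
rewrite normrMn -[_ *+ 4]mulr_natr.
have -> : 4 * y ^+ 3 = y ^+ 4 * (y^-1 * 4) by field; rewrite gt_eqF.
by rewrite ler_wpM2l ?exprn_ge0 ?(ltW y0)// ler_wpM2r.
Qed.

Lemma is_derive_sqr t : is_derive t 1 (fun t : R => t ^+ 2) (2 * t).
Proof.
apply: is_derive_eq (is_deriveM (is_derive_id t 1) (is_derive_id t 1)) _.
by rewrite /GRing.scale/=; ring.
Qed.

Lemma xlogxE t : xlogx t = t * ln t.
Proof. by rewrite /xlogx; case: eqP => // ->; rewrite mul0r. Qed.

Lemma is_derive_xlogx_sqr t :
  is_derive t 1 (fun t => xlogx (t ^+ 2)) (2 * t * ln (t ^+ 2) + 2 * t).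
Proof.
have -> : (fun t => xlogx (t ^+ 2)) = (fun t : R => t ^+ 2 * ln (t ^+ 2)).
  by apply/funext => z; rewrite xlogxE.
have [->|t0] := eqVneq t 0; last first.
  have t2 : 0 < t ^+ 2 by rewrite exprn_even_gt0.
  have d1 := is_derive_sqr t.
  have d2 := @is_derive1_comp R (@ln R) (fun t => t ^+ 2) t _ _
    (is_derive1_ln t2) d1.
  have := is_deriveM d1 d2.
  move/is_derive_eq; apply; rewrite /= /GRing.scale/=.
  by field.
(* At 0 the formula evaluates to 0 whatever value [ln 0] takes, and the bound of order [3/2]
   confirms this derivative. *)
rewrite mulr0 mul0r addr0.
apply: (@is_derive0_small _ 4 (3/2)); first lra.
  by rewrite expr0n mul0r.
near=> z; have [->|z0] := eqVneq z 0.
  by rewrite expr0n mul0r normr0 mulr_ge0// powR_ge0.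
apply: ln_sqr_bound => //; near: z; apply: (@nbhs0_lt _ R); exact: ltr01.
Unshelve. all: by end_near. Qed.

Lemma derivable_xlogx_sqr2 t : 0 < t ->
  derivable (fun t : R => 2 * t * ln (t ^+ 2) + 2 * t) t 1.
Proof.
move=> t0.
have t2 : 0 < t ^+ 2 by rewrite exprn_gt0.
have d1 := is_derive_sqr t.
have d2 := @is_derive1_comp R (@ln R) (fun t => t ^+ 2) t _ _
    (is_derive1_ln t2) d1.
have d3 : derivable (fun t : R => 2 * t) t 1 by exact: derivableM.
apply: derivableD => //; apply: derivableM => //.
Qed.

End OneVariable.

(** * Differentials *)

Section Differentials.
Context (R : realType) (U : normedModType R).
Implicit Types (f g L : U -> R) (w z h k : U).

(** The differential is recorded as a plain function, not as a bundled linear map, so that explicit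
    formulas can be assembled by the closure lemmas and rewritten pointwise. *)
Definition has_diff f z L := differentiable f z /\ forall k, 'd f z k = L k.

Lemma has_diff_ext f z (L L' : U -> R) : (forall k, L k = L' k) ->
  has_diff f z L -> has_diff f z L'.
Proof. by move=> LL' [fd fL]; split=> // k; rewrite fL. Qed.

Lemma has_diff_lin f z : linear f -> continuous f -> has_diff f z f.
Proof.
move=> fl fc; pose f' := GRing.isLinear.Build _ _ _ _ f fl.
pose F : {linear U -> R} := HB.pack f f'.
split; first exact: (@linear_differentiable _ _ _ F).
move=> k.
by have /(congr1 (fun u : U -> R => u k)) := @diff_lin _ _ _ F z fc.
Qed.

Lemma has_diff_cst (c : R) z : has_diff (fun=> c) z (fun=> 0).
Proof. by split=> [|k]; [exact: differentiable_cst | rewrite diff_cst]. Qed.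

Lemma has_diffD f g z (L L' : U -> R) : has_diff f z L -> has_diff g z L' ->
  has_diff (fun x => f x + g x) z (fun k => L k + L' k).
Proof.
move=> [fd fL] [gd gL]; split=> [|k]; first exact: differentiableD.
rewrite -fL -gL.
by have /(congr1 (fun u : U -> R => u k)) := diffD fd gd.
Qed.

Lemma has_diffM f g z (L L' : U -> R) : has_diff f z L -> has_diff g z L' ->
  has_diff (fun x => f x * g x) z (fun k => f z * L' k + g z * L k).
Proof.
move=> [fd fL] [gd gL]; split=> [|k]; first exact: differentiableM.
rewrite -fL -gL.
by have /(congr1 (fun u : U -> R => u k)) := diffM fd gd.
Qed.

Lemma has_diffZ (c : R) f z L : has_diff f z L ->
  has_diff (fun x => c * f x) z (fun k => c * L k).
Proof.
move=> fL; apply: has_diff_ext (has_diffM (has_diff_cst c z) fL) => k /=.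
by rewrite mulr0 addr0.
Qed.

Lemma has_diff_sum (I : Type) (s : seq I) (P : pred I) (F L : I -> U -> R) z :
  (forall i, P i -> has_diff (F i) z (L i)) ->
  has_diff (fun x => \sum_(i <- s | P i) F i x) z
           (fun k => \sum_(i <- s | P i) L i k).
Proof.
move=> FL; elim: s => [|i s IH].
  under eq_fun do rewrite big_nil; under [X in has_diff _ _ X]eq_fun do
    rewrite big_nil; exact: has_diff_cst.
have [Pi|/negbTE Pi] := boolP (P i);
  under eq_fun do rewrite big_cons Pi;
  under [X in has_diff _ _ X]eq_fun do rewrite big_cons Pi; last exact: IH.
by apply: has_diffD => //; exact: FL.
Qed.

Lemma has_diff_outer (g : R -> R) (dg : R) f z L : is_derive (f z) 1 g dg ->
  has_diff f z L -> has_diff (fun x => g (f x)) z (fun k => dg * L k).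
Proof.
move=> [gd gE] [fd fL].
have gd' : differentiable g (f z) by exact/derivable1_diffP.
split; first exact: differentiable_comp.
move=> k; rewrite -fL.
have /(congr1 (fun u : U -> R => u k)) := diff_comp fd gd'.
by move=> /= ->; rewrite deriv1E// derive1E gE mulrC.
Qed.

Lemma has_diff_is_derive f z L k : has_diff f z L -> is_derive z k f (L k).
Proof.
by move=> [fd fL]; split; [exact: diff_derivable | rewrite deriveE].
Qed.

Lemma has_diff_uniq f z (L L' : U -> R) k :
  has_diff f z L -> has_diff f z L' -> L k = L' k.
Proof. by move=> [_ <-] [_ <-]. Qed.

Lemma near0_diff (W : normedModType R) (r : U -> W) z :
  (\forall x \near z, r x = 0) -> differentiable r z /\ forall k, 'd r z k = 0.
Proof.
move=> r0.
have oE : r \o shift z = cst (r z) + (\0 : U -> W) +o_ (0 : U) id.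
  apply/eqaddoP => eps eps0.
  have rz : r z = 0 by exact: nbhs_singleton r0.
  have r0' : \forall x \near (0 : U), r (z + x) = 0.
    exact: (nbhs0P (fun x => r x = 0) z).1.
  near=> x; rewrite !fctE /= rz.
  have -> : r (x + z) = 0 by rewrite addrC; near: x.
  by rewrite addr0 subr0 normr0 mulr_ge0// ltW.
have c0 : continuous (\0 : U -> W) by exact: cst_continuous.
have dr : 'd r z = \0 :> (U -> W) by exact: diff_unique oE.
split; first by apply/diff_locallyP; rewrite dr.
exact: (fun k => congr1 (fun u : U -> W => u k) dr).
Unshelve. all: by end_near. Qed.

(** The difference [g - f] vanishes near [z], hence has zero differential there, and [g] is [f] plus
    this remainder. *)
Lemma near_differentiable (W : normedModType R) (f g : U -> W) z :
  (\forall x \near z, f x = g x) -> differentiable f z ->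
  differentiable g z /\ forall k, 'd g z k = 'd f z k.
Proof.
move=> fg fd.
have [r [gE rd r0]] : exists r : U -> W,
    [/\ g = f + r, differentiable r z & forall k, 'd r z k = 0].
  exists (g - f); have [] : differentiable (g - f) z /\
      forall k, 'd (g - f) z k = 0.
    by apply: near0_diff; apply: filterS fg => x /= fgx;
      rewrite !fctE fgx subrr.
  by move=> ? ?; split=> //; rewrite addrC subrK.
rewrite gE; split=> [|k]; first exact: differentiableD.
apply: etrans (congr1 (fun u : U -> W => u k) (diffD fd rd)) _.
apply: etrans (congr1 (fun u => 'd f z k + u) (r0 k)) _.
exact: addr0.
Qed.

Lemma near_has_diff f g z L : (\forall x \near z, f x = g x) ->
  has_diff f z L -> has_diff g z L.
Proof.
move=> fg [fd fL]; have [gd gE] := near_differentiable fg fd.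
by split=> [//|k]; exact: etrans (gE k) (fL k).
Qed.

(* Symmetry of the second differential is carried through the closure lemmas
   rather than obtained from Schwarz's theorem. *)
Definition twice_diff_at f (df : U -> U -> R) w :=
  (forall z, has_diff f z (df z)) /\
  exists2 d2 : U -> U -> R,
    forall k, has_diff (fun z => df z k) w (d2 k) & forall h k, d2 h k = d2 k h.

Implicit Types (df dg : U -> U -> R).

Lemma twice_diff_at_lin f w : linear f -> continuous f ->
  twice_diff_at f (fun=> f) w.
Proof.
move=> fl fc; split; first by move=> z; exact: has_diff_lin.
by exists (fun _ _ => 0) => // k; exact: has_diff_cst.
Qed.

Lemma twice_diff_at_cst (c : R) w : twice_diff_at (fun=> c) (fun _ _ => 0) w.
Proof.
split; first by move=> z; exact: has_diff_cst.
by exists (fun _ _ => 0) => // k; exact: has_diff_cst.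
Qed.

Lemma twice_diff_atD f df g dg w :
  twice_diff_at f df w -> twice_diff_at g dg w ->
  twice_diff_at (fun z => f z + g z) (fun z k => df z k + dg z k) w.
Proof.
move=> [f1 [d2f f2 f3]] [g1 [d2g g2 g3]].
split; first by move=> z; exact: has_diffD.
exists (fun k h => d2f k h + d2g k h); first by move=> k; exact: has_diffD.
by move=> h k; rewrite f3 g3.
Qed.

Lemma twice_diff_atM f df g dg w :
  twice_diff_at f df w -> twice_diff_at g dg w ->
  twice_diff_at (fun z => f z * g z) (fun z k => f z * dg z k + g z * df z k) w.
Proof.
move=> [f1 [d2f f2 f3]] [g1 [d2g g2 g3]].
split; first by move=> z; exact: has_diffM.
eexists=> [k|h k].
  by apply: has_diffD; apply: has_diffM.
rewrite /= f3 g3; ring.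
Qed.

Lemma twice_diff_atZ (c : R) f df w : twice_diff_at f df w ->
  twice_diff_at (fun z => c * f z) (fun z k => c * df z k) w.
Proof.
move=> [f1 [d2f f2 f3]]; split; first by move=> z; exact: has_diffZ.
exists (fun k h => c * d2f k h); first by move=> k; exact: has_diffZ.
by move=> h k; rewrite f3.
Qed.

Lemma twice_diff_atB f df g dg w :
  twice_diff_at f df w -> twice_diff_at g dg w ->
  twice_diff_at (fun z => f z - g z) (fun z k => df z k - dg z k) w.
Proof.
move=> fd gd; have := twice_diff_atD fd (twice_diff_atZ (-1) gd).
by congr twice_diff_at; do 2?[apply/funext => ?]; rewrite mulN1r.
Qed.

Lemma twice_diff_at_sum (I : Type) (s : seq I) (P : pred I)
    (F : I -> U -> R) (dF : I -> U -> U -> R) w :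
  (forall i, P i -> twice_diff_at (F i) (dF i) w) ->
  twice_diff_at (fun z => \sum_(i <- s | P i) F i z)
                (fun z k => \sum_(i <- s | P i) dF i z k) w.
Proof.
move=> Fd; elim: s => [|i s IH].
  under eq_fun do rewrite big_nil.
  under [X in twice_diff_at _ X]eq_fun do under eq_fun do rewrite big_nil.
  exact: twice_diff_at_cst.
have [Pi|/negbTE Pi] := boolP (P i);
  under eq_fun do rewrite big_cons Pi;
  under [X in twice_diff_at _ X]eq_fun do under eq_fun do rewrite big_cons Pi;
  last exact: IH.
exact: twice_diff_atD (Fd _ Pi) IH.
Qed.

(** The asymmetry is deliberate: [t^2 log t^2] has a first derivative everywhere, but a second one
    is only available away from 0, so [dg] is differentiated at [f w] alone. *)
Lemma twice_diff_at_outer (g dg : R -> R) f df w :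
  (forall t : R, is_derive t 1 g (dg t)) -> derivable dg (f w) 1 ->
  twice_diff_at f df w ->
  twice_diff_at (fun z => g (f z)) (fun z k => dg (f z) * df z k) w.
Proof.
move=> gd dgd [f1 [d2f f2 f3]].
split; first by move=> z; exact: has_diff_outer.
eexists=> [k|h k].
  apply: has_diffM (f2 k); apply: has_diff_outer (f1 w).
  exact: derivableP dgd.
rewrite /= f3; ring.
Qed.

End Differentials.

Lemma has_diff_comp (R : realType) (U U' : normedModType R) (f L : U -> R)
    (g : U' -> U) (z : U') :
  differentiable g z -> has_diff f (g z) L ->
  has_diff (fun x => f (g x)) z (fun k => L ('d g z k)).
Proof.
move=> gd [fd fL]; split; first exact: differentiable_comp.
move=> k; rewrite -fL.
by have /(congr1 (fun u : U' -> R => u k)) := diff_comp gd fd.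
Qed.

(** * Differentiation along rays and lines; first and second order conditions at a minimum *)

Section Calculus.
Context (R : realType).

Lemma has_diff_additive (U : normedModType R) (f L : U -> R) z h k :
  has_diff f z L -> L (h + k) = L h + L k.
Proof. by case=> _ E; rewrite -!E linearD. Qed.

Lemma has_diff_homogeneous (U : normedModType R) (f L : U -> R) z (c : R) k :
  has_diff f z L -> L (c *: k) = c * L k.
Proof. by case=> _ E; rewrite -!E linearZ. Qed.

Lemma has_diff_ray (U : normedModType R) (f L : U -> R) w :
  has_diff f w L -> is_derive (1 : R) 1 (fun t : R => f (t *: w)) (L w).
Proof.
move=> fL.
have [sd sE] : is_diff (1 : R) (fun t : R => t *: w) (fun t : R => t *: w).
  exact: is_diff_scalel.
have fL' : has_diff f ((1 : R) *: w) L by rewrite scale1r.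
have := has_diff_is_derive (1 : R) (has_diff_comp sd fL').
by move/is_derive_eq; apply; rewrite sE scale1r.
Qed.

Lemma has_diff_line (U : normedModType R) (f L : U -> R) w h (s : R) :
  has_diff f (w + s *: h) L ->
  is_derive s 1 (fun s : R => f (w + s *: h)) (L h).
Proof.
move=> fL.
have [sd sE] : is_diff s (fun t : R => w + t *: h) (fun t : R => t *: h).
  have [d0 E0] : is_diff s (cst w : R -> U) (cst 0) by exact: is_diff_cst.
  have [d1 E1] : is_diff s (fun t : R => t *: h) (fun t : R => t *: h).
    exact: is_diff_scalel.
  apply: DiffDef; first exact: differentiableD.
  by apply: etrans (diffD d0 d1) _; rewrite E0 E1;
    apply/funext => t; exact: add0r.
have := has_diff_is_derive (1 : R) (has_diff_comp sd fL).
by move/is_derive_eq; apply; rewrite sE scale1r.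
Qed.

(** Euler's identity with a logarithmic correction: both sides are differentiated in [t] at 1, where
    [ln (t ^+ 2)] vanishes and has derivative 2. *)
Lemma euler_log (U : normedModType R) (f L : U -> R) w (q c A B : R) :
  has_diff f w L ->
  (forall t : R, 0 < t ->
    f (t *: w) = t `^ q * A - c * (t `^ q * ln (t ^+ 2)) * B) ->
  L w = q * A - 2 * c * B.
Proof.
move=> fL fE; have D1 := has_diff_ray fL.
have E : \forall t \near (1 : R),
    t `^ q * A - c * (t `^ q * ln (t ^+ 2)) * B = f (t *: w).
  by near=> t; rewrite -fE//; near: t; exact: lt_nbhsr.
have Dp := @is_derive1_powR R q 1 ltr01.
have t1 : 0 < (1 : R) ^+ 2 by rewrite expr1n.
have Dl := @is_derive1_comp R (@ln R) (fun t => t ^+ 2) 1 _ _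
  (is_derive1_ln t1) (is_derive_sqr 1).
have D2 := near_eq_is_derive E (is_deriveB (is_deriveM Dp (is_derive_cst A _ _))
  (is_deriveM (is_deriveM (is_derive_cst c _ _) (is_deriveM Dp Dl))
     (is_derive_cst B _ _))).
rewrite -(@derive_val _ _ _ _ _ _ _ D1) (@derive_val _ _ _ _ _ _ _ D2).
rewrite /GRing.scale /= !powR1 !expr1n ln1 invr1; ring.
Unshelve. all: by end_near. Qed.

Lemma local_min_is_derive (g : R -> R) (dg : R -> R) :
  (forall s : R, is_derive s 1 g (dg s)) ->
  (\forall s \near (0 : R), g 0 <= g s) -> dg 0 = 0.
Proof.
move=> gd /nbhs_normP[eps /= eps0 gmin].
have [] := @derive1_at_min R g (- eps) eps 0 _ _ _ _.
- by rewrite gt0_cp.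
- by move=> t _; exact: ex_derive.
- by rewrite in_itv/= oppr_lt0 eps0.
- move=> t; rewrite in_itv/= => /andP[t1 t2]; apply: gmin => /=.
  by rewrite sub0r normrN ltr_norml t1.
- by move=> _; rewrite derive_val.
Qed.

Lemma is_derive0_cvg (f : R -> R) D : is_derive (0 : R) 1 f D -> f 0 = 0 ->
  h^-1 * f h @[h --> (0 : R)^'] --> D.
Proof.
move=> [fd <-] f0.
have E : (fun h : R => h^-1 *: ((f \o shift 0) (h *: 1) - f 0)) =
         (fun h : R => h^-1 * f h).
  by apply/funext => h /=; rewrite f0 subr0 addr0 [h *: 1]mulr1.
have : (fun h : R => h^-1 *: ((f \o shift 0) (h *: 1) - f 0)) @ (0 : R)^' -->
  'D_1 f 0 by exact: fd.
by rewrite E.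
Qed.

(** If [D < 0], then for small [s > 0] one has [g s - g 0 <= (D/4) s^2], while [m s = o(s)] keeps
    the penalty below [(- D/8) s^2]; the sum is then negative. *)
Lemma second_order_condition (g g1 m : R -> R) (D C : R) :
  (forall s : R, is_derive s 1 g (g1 s)) -> g1 0 = 0 ->
  is_derive (0 : R) 1 g1 D -> m 0 = 0 -> is_derive (0 : R) 1 m 0 ->
  (\forall s \near (0 : R), 0 <= g s - g 0 + C * m s ^+ 2) -> 0 <= D.
Proof.
move=> gd g10 g1d m0 md gm.
rewrite leNgt; apply/negP => D0.
have q1 := is_derive0_cvg g1d g10.
have q2 := is_derive0_cvg md m0.
(* The bound 1 gives [eta^2 <= eta]; the other bound gives [(|C| + 1) * eta <= - D / 8]. Adding 1 to
   [|C|] avoids a zero denominator. *)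
pose eta := Num.min 1 (- D / (8 * (`|C| + 1))).
have C1 : 0 < `|C| + 1 by rewrite ltr_wpDl.
have eta0 : 0 < eta by rewrite lt_min ltr01/= divr_gt0 ?mulr_gt0// oppr_gt0.
have near_all : \forall s \near (0 : R)^',
    [/\ s^-1 * g1 s < D / 2, `|s^-1 * m s| < eta &
        0 <= g s - g 0 + C * m s ^+ 2].
  near=> s; split.
  - near: s; apply: (cvgr_lt _ q1); lra.
  - near: s; exact: (cvgr0_norm_lt _ q2).
  - near: s; exact: nbhs_dnbhs.
have [d /= d0 dP] : exists2 d : R, 0 < d & forall s, 0 < s -> s < d ->
    [/\ s^-1 * g1 s < D / 2, `|s^-1 * m s| < eta &
        0 <= g s - g 0 + C * m s ^+ 2].
  have [d /= d0 dP] := near_all.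
  exists d => // s s0 sd; apply: dP; last by rewrite gt_eqF.
  by rewrite /ball /= sub0r normrN gtr0_norm.
pose s := d / 2.
have s0 : 0 < s by rewrite divr_gt0.
have sd : s < d by rewrite /s; lra.
(* The mean value theorem is applied to [g t - (D/4) t^2], whose derivative is negative on [(0, s]]
   because [g1 t / t < D / 2] there. *)
have rd (t : R) : is_derive t 1 (fun t => g t - D / 4 * t ^+ 2)
    (g1 t - D / 2 * t).
  have rt := is_deriveB (gd t) (is_deriveZ (D / 4) (is_derive_sqr t)).
  apply: is_derive_eq rt _.
  by rewrite /GRing.scale/=; field.
have rc : {within `[0, s], continuous (fun t => g t - D / 4 * t ^+ 2)}.
  by apply: derivable_within_continuous => t _; have [] := rd t.
have [c] := MVT s0 (fun t _ => rd t) rc.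
rewrite in_itv/= => /andP[c0 cs] E.
have [c1 _ _] := dP c c0 (lt_trans cs sd).
have [_ s2 s3] := dP s s0 sd.
have g1c : g1 c - D / 2 * c < 0.
  by rewrite subr_lt0 mulrC -ltr_pdivrMl.
have gs : g s - g 0 <= D / 4 * s ^+ 2.
  have : (g1 c - D / 2 * c) * (s - 0) <= 0 by rewrite nmulr_rle0// subr0 ltW.
  rewrite -E expr0n/= mulr0 subr0; lra.
have ms : C * m s ^+ 2 <= - D / 8 * s ^+ 2.
  have me : `|m s| <= eta * s.
    move: s2; rewrite normrM normfV (gtr0_norm s0) ltr_pdivrMl//.
    by rewrite mulrC => /ltW.
  have m2 : m s ^+ 2 <= eta * s ^+ 2.
    rewrite -real_normK ?num_real// (@le_trans _ _ ((eta * s) ^+ 2))//.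
      by rewrite lerXn2r ?nnegrE ?mulr_ge0// ltW.
    rewrite exprMn ler_wpM2r ?sqr_ge0// expr2 ger_pMr//.
    by rewrite ge_min lexx.
  have eC : (`|C| + 1) * eta <= - D / 8.
    rewrite mulrC -ler_pdivlMr// ge_min; apply/orP; right.
    by rewrite le_eqVlt; apply/orP; left; apply/eqP; field; rewrite gt_eqF.
  apply: le_trans (_ : (`|C| + 1) * (eta * s ^+ 2) <= _).
    apply: le_trans (_ : (`|C| + 1) * m s ^+ 2 <= _).
      by rewrite ler_wpM2r ?sqr_ge0// (le_trans (ler_norm C))// lerDl.
    by rewrite ler_wpM2l// ltW.
  by rewrite mulrA ler_wpM2r// sqr_ge0.
have : 0 < s ^+ 2 by rewrite exprn_gt0.
have : D / 8 * s ^+ 2 < 0 by rewrite nmulr_rlt0 ?exprn_gt0//; lra.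
by move: s3 gs ms; lra.
Unshelve. all: by end_near. Qed.

End Calculus.

(** * The energy and its differential *)

Section Energy.
Context (R : realType) (V : finType) (e : rel V) (p : R).
Context (p_gt4 : 4 < p).
Implicit Types (a b u v : fct R V) (w k : fct2 R V) (x y : V).

Lemma at_vertexD u v x : (u + v)\@x = u\@x + v\@x.
Proof. by rewrite /at_vertex mxE. Qed.

Lemma at_vertexZ (c : R) u x : (c *: u)\@x = c * u\@x.
Proof. by rewrite /at_vertex mxE. Qed.

Lemma at_vertex0 x : (0 : fct R V)\@x = 0.
Proof. by rewrite /at_vertex mxE. Qed.

(** The square of [grad_norm], a polynomial in [u]. The gradient term becomes its power [p / 2 > 2],
    so no square root has to be differentiated at 0. *)
Definition dirichlet u x : R := 2^-1 * \sum_(y : V | e x y) (u\@y - u\@x) ^+ 2.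

Definition ddirichlet u v x : R :=
  \sum_(y : V | e x y) (u\@y - u\@x) * (v\@y - v\@x).

Lemma dirichlet_ge0 u x : 0 <= dirichlet u x.
Proof. by rewrite mulr_ge0 ?invr_ge0// sumr_ge0// => y _; exact: sqr_ge0. Qed.

Lemma grad_norm_powR u x : grad_norm e u x `^ p = `|dirichlet u x| `^ (p / 2).
Proof.
rewrite ger0_norm ?dirichlet_ge0// mulrC powRrM powR12_sqrt//.
exact: dirichlet_ge0.
Qed.

Definition dnormHp a u v : R :=
  \sum_x (p / 2 * spowR (p / 2 - 1) (dirichlet u x) * ddirichlet u v x
          + a\@x * (p * spowR (p - 1) u\@x * v\@x)).

Definition dxlogx_sqr (t : R) : R := 2 * t * ln (t ^+ 2) + 2 * t.

(** The differential of [|s|^(p-2) t^2 log t^2] in the direction [(ds, dt)], where [s] and [t] stand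
    for the values of the two components at one vertex. *)
Definition dlog_term (s t ds dt : R) : R :=
  `|s| `^ (p - 2) * (dxlogx_sqr t * dt)
  + xlogx (t ^+ 2) * ((p - 2) * spowR (p - 2 - 1) s * ds).

Definition dJ a b w k : R :=
  p^-1 * (dnormHp a w.1 k.1 + dnormHp b w.2 k.2)
  - p^-1 * \sum_x (dlog_term w.1\@x w.2\@x k.1\@x k.2\@x
                   + dlog_term w.2\@x w.1\@x k.2\@x k.1\@x).

Definition dmass_term (s t ds dt : R) : R :=
  `|s| `^ (p - 2) * (t * dt + t * dt)
  + t ^+ 2 * ((p - 2) * spowR (p - 2 - 1) s * ds).

Definition dmass w k : R :=
  \sum_x (dmass_term w.1\@x w.2\@x k.1\@x k.2\@x
          + dmass_term w.2\@x w.1\@x k.2\@x k.1\@x).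

Section OneComponent.
Context (U : normedModType R) (q : U -> fct R V).
Context (q_lin : linear q) (q_cont : continuous q).

(** The abstract map [q] lets one computation serve both projections of [fct2 R V], and also the
    identity when the potential is the variable. *)
Lemma twice_diff_at_vertex x (w : U) :
  twice_diff_at (fun z => (q z)\@x) (fun _ (k : U) => (q k)\@x) w.
Proof.
apply: twice_diff_at_lin => [c u v|z].
  by rewrite q_lin at_vertexD at_vertexZ.
apply: (@continuous_comp _ _ _ q (fun u => at_vertex u x)); first exact: q_cont.
exact: coord_continuous.
Qed.

Lemma twice_diff_at_powR_norm r (f : U -> R) (df : U -> U -> R) (w : U) :
  2 < r -> twice_diff_at f df w ->
  twice_diff_at (fun z => `|f z| `^ r)
    (fun z (k : U) => r * spowR (r - 1) (f z) * df z k) w.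
Proof.
move=> r2 fd.
apply: (@twice_diff_at_outer _ _ (fun t : R => `|t| `^ r)
         (fun t => r * spowR (r - 1) t)) fd.
  by move=> t; apply: is_derive_powR_norm; rewrite (lt_trans _ r2)// ltr1n.
apply: derivableM => //.
by apply: ex_derive; apply: is_derive_spowR; rewrite ltrBrDr.
Qed.

Lemma twice_diff_at_dirichlet x (w : U) :
  twice_diff_at (fun z => dirichlet (q z) x)
    (fun z (k : U) => ddirichlet (q z) (q k) x) w.
Proof.
have D y := twice_diff_atB (twice_diff_at_vertex y w)
  (twice_diff_at_vertex x w).
have := twice_diff_atZ 2^-1 (@twice_diff_at_sum _ _ _ (index_enum V) (e x)
  _ _ w (fun y _ => twice_diff_atM (D y) (D y))).
congr twice_diff_at; apply/funext => z; apply/funext => k.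
rewrite mulr_sumr; apply: eq_bigr => y _.
by field.
Qed.

Lemma twice_diff_at_normHp a (w : U) :
  twice_diff_at (fun z => normHp e p a (q z))
    (fun z (k : U) => dnormHp a (q z) (q k)) w.
Proof.
apply: twice_diff_at_sum => x _; apply: twice_diff_atD.
  under eq_fun do rewrite grad_norm_powR.
  apply: twice_diff_at_powR_norm; last exact: twice_diff_at_dirichlet.
  by move: p_gt4; lra.
apply: twice_diff_atZ; apply: twice_diff_at_powR_norm.
  by move: p_gt4; lra.
exact: twice_diff_at_vertex.
Qed.

End OneComponent.

Lemma linear_fst : linear (fst : fct2 R V -> fct R V). Proof. by []. Qed.
Lemma linear_snd : linear (snd : fct2 R V -> fct R V). Proof. by []. Qed.

Lemma continuous_fst' : continuous (fst : fct2 R V -> fct R V).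
Proof. by move=> z; exact: cvg_fst. Qed.
Lemma continuous_snd' : continuous (snd : fct2 R V -> fct R V).
Proof. by move=> z; exact: cvg_snd. Qed.

Let td1 x w := twice_diff_at_vertex linear_fst continuous_fst' x w.
Let td2 x w := twice_diff_at_vertex linear_snd continuous_snd' x w.

Lemma twice_diff_at_log_term (s t : fct2 R V -> R) ds dt w : 0 < t w ->
  twice_diff_at s ds w -> twice_diff_at t dt w ->
  twice_diff_at (fun z => `|s z| `^ (p - 2) * xlogx (t z ^+ 2))
    (fun z k => dlog_term (s z) (t z) (ds z k) (dt z k)) w.
Proof.
move=> t0 sd td; apply: twice_diff_atM.
  by apply: twice_diff_at_powR_norm => //; move: p_gt4; lra.
apply: (@twice_diff_at_outer _ _ (fun t : R => xlogx (t ^+ 2)) dxlogx_sqr) td.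
  exact: is_derive_xlogx_sqr.
exact: derivable_xlogx_sqr2.
Qed.

Lemma twice_diff_at_J a b w : (forall x, 0 < w.1\@x /\ 0 < w.2\@x) ->
  twice_diff_at (J e p a b) (dJ a b) w.
Proof.
move=> w0; apply: twice_diff_atB; apply: twice_diff_atZ.
  apply: twice_diff_atD.
    exact: (twice_diff_at_normHp linear_fst continuous_fst').
  exact: (twice_diff_at_normHp linear_snd continuous_snd').
apply: twice_diff_at_sum => x _; have [u0 v0] := w0 x.
apply: twice_diff_atD.
  exact: twice_diff_at_log_term v0 (td1 x w) (td2 x w).
exact: twice_diff_at_log_term u0 (td2 x w) (td1 x w).
Qed.

Lemma twice_diff_at_mass w : twice_diff_at (mass p) dmass w.
Proof.
apply: twice_diff_at_sum => x _; apply: twice_diff_atD; apply: twice_diff_atM.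
- by apply: twice_diff_at_powR_norm (td1 x w); move: p_gt4; lra.
- exact: twice_diff_atM.
- by apply: twice_diff_at_powR_norm (td2 x w); move: p_gt4; lra.
- exact: twice_diff_atM.
Qed.

Lemma has_diff_J a b z : has_diff (J e p a b) z (dJ a b z).
Proof.
(* The first-order half of [twice_diff_at] holds at every point, so any strictly positive reference
   point gives access to it. *)
pose w1 : fct2 R V := (const_mx 1, const_mx 1).
have w0 x : 0 < w1.1\@x /\ 0 < w1.2\@x by split; rewrite /at_vertex mxE ltr01.
exact: (twice_diff_at_J a b w0).1.
Qed.

Lemma has_diff_mass z : has_diff (mass p) z (dmass z).
Proof. exact: (twice_diff_at_mass z).1. Qed.

End Energy.

(** * Ground states *)

Section Nehari.
Context (R : realType) (V : finType) (e : rel V) (p : R).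
Context (p_gt4 : 4 < p).
Implicit Types (a b u v : fct R V) (w z h k : fct2 R V) (x y : V).

Let p0 : 0 < p. Proof. by apply: lt_trans p_gt4. Qed.
Let pn0 : p != 0. Proof. by rewrite gt_eqF. Qed.

Lemma powR_normM (t s r : R) : 0 < t -> `|t * s| `^ r = t `^ r * `|s| `^ r.
Proof.
move=> t0; rewrite normrM (gtr0_norm t0) powRM//.
exact: ltW.
Qed.

Lemma powR_sqr (t r : R) : 0 < t -> (t ^+ 2) `^ r = t `^ (2 * r).
Proof. by move=> t0; rewrite powRrM powR_mulrn// ltW. Qed.

Lemma powR_split2 (t : R) : 0 < t -> t `^ p = t `^ (p - 2) * t ^+ 2.
Proof.
move=> t0; rewrite -powR_mulrn ?ltW// -powRD ?subrK//.
by rewrite (gt_eqF t0) implybT.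
Qed.

Lemma normHpZ a (t : R) u : 0 < t ->
  normHp e p a (t *: u) = t `^ p * normHp e p a u.
Proof.
move=> t0; rewrite mulr_sumr; apply: eq_bigr => x _.
rewrite mulrDr at_vertexZ powR_normM//; congr (_ + _); last by rewrite mulrCA.
rewrite !grad_norm_powR.
have -> : dirichlet e (t *: u) x = t ^+ 2 * dirichlet e u x.
  rewrite /dirichlet mulrCA; congr (_ * _); rewrite mulr_sumr.
  by apply: eq_bigr => y _; rewrite !at_vertexZ -mulrBr exprMn.
rewrite powR_normM ?exprn_gt0// powR_sqr//; congr (_ `^ _ * _).
by field.
Qed.

Lemma xlogx_sqrM (t s : R) : 0 < t ->
  xlogx ((t * s) ^+ 2) = t ^+ 2 * (xlogx (s ^+ 2) + ln (t ^+ 2) * s ^+ 2).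
Proof.
move=> t0; rewrite !xlogxE exprMn; have [->|s0] := eqVneq s 0.
  by rewrite expr0n/= !(mulr0, mul0r) addr0 mulr0.
have s2 : 0 < s ^+ 2 by rewrite exprn_even_gt0.
have t2 : 0 < t ^+ 2 by rewrite exprn_gt0.
by rewrite lnM ?posrE//; ring.
Qed.

Lemma massZ (t : R) w : 0 < t -> mass p (t *: w) = t `^ p * mass p w.
Proof.
move=> t0; rewrite mulr_sumr; apply: eq_bigr => x _.
rewrite /= !at_vertexZ !powR_normM// powR_split2//; ring.
Qed.

Lemma JZ a b (t : R) w : 0 < t ->
  J e p a b (t *: w) =
  t `^ p * J e p a b w - p^-1 * (t `^ p * ln (t ^+ 2)) * mass p w.
Proof.
move=> t0; rewrite /J /= !normHpZ//.
set B := \sum_x _; set B' := \sum_x _.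
have -> : B = t `^ p * B' + t `^ p * ln (t ^+ 2) * mass p w.
  rewrite /mass !mulr_sumr -big_split; apply: eq_bigr => x _ /=.
  rewrite !at_vertexZ !powR_normM// !xlogx_sqrM// powR_split2//; ring.
ring.
Qed.

Lemma dJ_self a b w : dJ e p a b w w = p * J e p a b w - 2 / p * mass p w.
Proof.
rewrite (euler_log (q := p) (has_diff_J e p_gt4 a b w)
  (fun t t0 => JZ a b w t0)).
by rewrite mulrAC.
Qed.

Lemma dmass_self w : dmass p w w = p * mass p w.
Proof.
rewrite (euler_log (q := p) (c := 0) (A := mass p w) (B := 0)
  (has_diff_mass p_gt4 w)).
  by rewrite !mulr0 subr0.
by move=> t t0; rewrite massZ// mulr0 subr0.
Qed.

(** Differentiating [JZ] in [w] produces [t * dJ (t w)]; cancelling one factor [t] lowers the degree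
    to [p - 1]. *)
Lemma dJZ a b (t : R) w k : 0 < t ->
  dJ e p a b (t *: w) k =
  t `^ (p - 1) * dJ e p a b w k
  - p^-1 * (t `^ (p - 1) * ln (t ^+ 2)) * dmass p w k.
Proof.
move=> t0; have tn0 : t != 0 by rewrite gt_eqF.
apply: (mulfI tn0).
have [sd sE] : is_diff w ( *:%R t) ( *:%R t) by exact: is_diff_scaler.
have D1 := has_diff_comp sd (has_diff_J e p_gt4 a b (t *: w)).
have {D1} D1 : has_diff (fun z => J e p a b (t *: z)) w
    (fun k => t * dJ e p a b (t *: w) k).
  apply: has_diff_ext D1 => h; rewrite sE.
  exact: has_diff_homogeneous (has_diff_J e p_gt4 a b (t *: w)).
have D2 : has_diff (fun z => J e p a b (t *: z)) w
    (fun k => t `^ p * dJ e p a b w k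
              + - (p^-1 * (t `^ p * ln (t ^+ 2))) * dmass p w k).
  under eq_fun do rewrite JZ// -mulNr.
  exact: has_diffD (has_diffZ _ (has_diff_J _ _ _ _ _))
                   (has_diffZ _ (has_diff_mass _ _)).
rewrite (has_diff_uniq k D1 D2) -mulr_powRB1 ?(ltW t0)//; ring.
Qed.

Lemma dJ_d2_self a b w k (d2 : fct2 R V -> R) :
  has_diff (fun z => dJ e p a b z k) w d2 ->
  d2 w = (p - 1) * dJ e p a b w k - 2 / p * dmass p w k.
Proof.
move=> D; rewrite (euler_log (q := p - 1) D (fun t t0 => dJZ a b w k t0)).
by rewrite mulrAC.
Qed.

Lemma GE a b w : G e p a b w = p * J e p a b w - 2 / p * mass p w.
Proof. by rewrite /G (has_diff_J e p_gt4 a b w).2 dJ_self. Qed.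

Lemma mass_ge0 w : 0 <= mass p w.
Proof.
by apply: sumr_ge0 => x _; rewrite addr_ge0// mulr_ge0 ?powR_ge0 ?sqr_ge0.
Qed.

Lemma mass_eq0P w : mass p w = 0 -> forall x,
  `|w.1\@x| `^ (p - 2) * w.2\@x ^+ 2 = 0 /\
  `|w.2\@x| `^ (p - 2) * w.1\@x ^+ 2 = 0.
Proof.
have H x : 0 <= `|w.1\@x| `^ (p - 2) * w.2\@x ^+ 2.
  by rewrite mulr_ge0 ?powR_ge0 ?sqr_ge0.
have H' x : 0 <= `|w.2\@x| `^ (p - 2) * w.1\@x ^+ 2.
  by rewrite mulr_ge0 ?powR_ge0 ?sqr_ge0.
move=> m0 x.
have /eqP := psumr_eq0P (fun x _ => addr_ge0 (H x) (H' x)) m0 (i := x) isT.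
by rewrite paddr_eq0// => /andP[/eqP-> /eqP->].
Qed.

Lemma normHp_ge0 a u : (forall x, 0 <= a\@x) -> 0 <= normHp e p a u.
Proof.
by move=> a0; apply: sumr_ge0 => x _; rewrite addr_ge0 ?mulr_ge0 ?powR_ge0.
Qed.

Lemma normHp_eq0 a u : (forall x, 0 < a\@x) -> normHp e p a u = 0 -> u = 0.
Proof.
move=> a0 /psumr_eq0P u0.
have {}u0 x : u\@x = 0.
  have /eqP : grad_norm e u x `^ p + a\@x * `|u\@x| `^ p = 0.
    by apply: u0 => // y _; rewrite addr_ge0 ?mulr_ge0 ?powR_ge0// ltW.
  rewrite paddr_eq0 ?mulr_ge0 ?powR_ge0 ?(ltW (a0 x))// => /andP[_].
  by rewrite mulf_eq0 (gt_eqF (a0 x)) powR_eq0 normr_eq0 => /andP[/eqP].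
apply/matrixP => i j; rewrite mxE ord1 -(u0 (enum_val i)) /at_vertex.
by rewrite enum_valK.
Qed.

(** If the mass were 0, every logarithmic term would vanish as well; then [G w = 0] makes both norms
    0, which forces [w = 0]. *)
Lemma nehari_mass_gt0 a b w : (forall x, 0 < a\@x /\ 0 < b\@x) ->
  nehari e p a b w -> 0 < mass p w.
Proof.
move=> ab0 [w0 /[!GE] Gw]; rewrite lt_def mass_ge0 andbT; apply/eqP => m0.
apply: w0; move: Gw; rewrite m0 mulr0 subr0 => /eqP.
rewrite mulf_eq0 (negbTE pn0)/= /J big1 => [|x _]; last first.
  have H (s t : R) : `|s| `^ (p - 2) * t ^+ 2 = 0 ->
      `|s| `^ (p - 2) * xlogx (t ^+ 2) = 0.
    move/eqP; rewrite mulf_eq0 => /orP[/eqP ->|]; first by rewrite mul0r.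
    by rewrite sqrf_eq0 => /eqP ->; rewrite xlogxE expr0n/= mul0r mulr0.
  by have [/H -> /H ->] := mass_eq0P m0 x; rewrite addr0.
rewrite mulr0 subr0 mulf_eq0 invr_eq0 (negbTE pn0)/=.
have a0 x := (ab0 x).1; have b0 x := (ab0 x).2.
rewrite paddr_eq0 ?normHp_ge0// => [|x|x]; [|exact/ltW..].
case/andP => /eqP/(normHp_eq0 a0) + /eqP/(normHp_eq0 b0).
by case: w {m0} => u v /= -> ->.
Qed.

Lemma nehari_J a b w : nehari e p a b w -> J e p a b w = 2 / p ^+ 2 * mass p w.
Proof.
move=> [_ /[!GE] /eqP]; rewrite subr_eq0 => /eqP E.
apply: (mulfI pn0); rewrite E; field.
exact: pn0.
Qed.

(* Projecting [w] radially onto the Nehari manifold gives the energy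
   [2/p^2 mass w exp(p G / (2 mass w))], which is bounded below by the ground
   state energy. *)
Lemma ground_state_penalized a b w0 w : (forall x, 0 < a\@x /\ 0 < b\@x) ->
  ground_state e p a b w0 -> 0 < mass p w ->
  0 <= J e p a b w - J e p a b w0 +
       2 / (p ^+ 2 * mass p w0) * (mass p w - mass p w0) ^+ 2.
Proof.
move=> ab0 [n0 wmin] m0.
have M0 := nehari_mass_gt0 ab0 n0.
pose g := p * J e p a b w - 2 / p * mass p w.
(* By [JZ] and [massZ], [G (t w) = t^p (g - ln (t^2) mass w)]; this [t] is the scale at which it
   vanishes. *)
pose t := expR (g / (2 * mass p w)).
have t0 : 0 < t by exact: expR_gt0.
have lnt : ln (t ^+ 2) = g / mass p w.
  by rewrite lnXn// expRK -mulr_natl; field; rewrite gt_eqF.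
have nt : nehari e p a b (t *: w).
  split.
    move=> tw0; have := massZ w t0; rewrite tw0.
    rewrite /mass big1 => [|x _]; last first.
      by rewrite /= !at_vertex0 expr0n/= !mulr0 addr0.
    by move/eqP; rewrite eq_sym mulf_eq0 (gt_eqF m0) gt_eqF ?powR_gt0.
  rewrite GE massZ// JZ// lnt /g; field.
  by rewrite pn0 gt_eqF.
have := wmin _ nt; rewrite (nehari_J nt) (nehari_J n0) massZ//.
have -> : t `^ p = expR (p * (g / (2 * mass p w))).
  by rewrite /powR gt_eqF// expRK.
set y := p * _ => le.
have {}le : mass p w0 <= expR y * mass p w.
  by move: le; rewrite ler_pM2l// divr_gt0// exprn_gt0.
(* The chain is [1 - y <= exp (- y) <= mass w / mass w0]. Multiplied by [2 mass w / p^2], it becomes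
   the claim, since [y] times that factor is [g / p]. *)
have y1 : 1 - y <= mass p w / mass p w0.
  rewrite (le_trans (expR_ge1Dx (- y)))// expRN.
  by rewrite ler_pdivlMr// mulrC ler_pdivrMr ?expR_gt0// mulrC.
have : 0 <= (mass p w / mass p w0 - 1 + y) * (2 * mass p w / p ^+ 2).
  rewrite mulr_ge0 ?divr_ge0 ?mulr_ge0 ?exprn_ge0 ?(ltW m0) ?(ltW p0)//.
  by move: y1; lra.
suff -> : (mass p w / mass p w0 - 1 + y) * (2 * mass p w / p ^+ 2) =
  J e p a b w - 2 / p ^+ 2 * mass p w0 +
       2 / (p ^+ 2 * mass p w0) * (mass p w - mass p w0) ^+ 2 by [].
rewrite /y /g; field.
by rewrite pn0 !gt_eqF.
Qed.

Lemma ground_state_near a b w0 h : (forall x, 0 < a\@x /\ 0 < b\@x) ->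
  ground_state e p a b w0 -> \forall s \near (0 : R),
  0 <= J e p a b (w0 + s *: h) - J e p a b w0 +
       2 / (p ^+ 2 * mass p w0) * (mass p (w0 + s *: h) - mass p w0) ^+ 2.
Proof.
move=> ab0 gs; have M0 := nehari_mass_gt0 ab0 gs.1.
have c : {for 0, continuous (fun s : R => mass p (w0 + s *: h))}.
  apply: differentiable_continuous; apply/derivable1_diffP.
  by have [] := has_diff_line (has_diff_mass p_gt4 (w0 + (0 : R) *: h)).
near=> s; apply: ground_state_penalized => //; near: s.
by apply: (cvgr_gt _ c); rewrite scale0r addr0.
Unshelve. all: by end_near. Qed.

(** The Nehari set is a natural constraint: along any line through [w0] the penalized energy has a
    local minimum, and the penalty has zero derivative there, so no multiplier survives. *)
Lemma ground_state_critical a b w0 h : (forall x, 0 < a\@x /\ 0 < b\@x) ->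
  ground_state e p a b w0 -> dJ e p a b w0 h = 0.
Proof.
move=> ab0 gs.
set C := 2 / (p ^+ 2 * mass p w0).
pose P (s : R) := mass p (w0 + s *: h) - mass p w0.
pose g (s : R) := J e p a b (w0 + s *: h) + C * P s ^+ 2.
have gd (s : R) : is_derive s 1 g
    (dJ e p a b (w0 + s *: h) h + C * (2 * P s * dmass p (w0 + s *: h) h)).
  have d1 := has_diff_line (has_diff_J e p_gt4 a b (w0 + s *: h)).
  have d2 := has_diff_line (has_diff_mass p_gt4 (w0 + s *: h)).
  have d3 : is_derive s 1 P (dmass p (w0 + s *: h) h).
    by apply: is_derive_eq (is_deriveB d2 (is_derive_cst _ _ _)) _;
      rewrite subr0.
  apply: is_derive_eq (is_deriveD d1 (is_deriveZ C (is_deriveM d3 d3))) _.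
  by rewrite /GRing.scale/=; ring.
have P0 : P 0 = 0 by rewrite /P scale0r addr0 subrr.
have := local_min_is_derive gd.
rewrite P0 !scale0r addr0 !(mulr0, mul0r) addr0; apply.
apply: filterS (ground_state_near h ab0 gs) => s.
rewrite /g P0 scale0r addr0 -/C -/(P s) expr0n mulr0 addr0; lra.
Qed.

Lemma ground_state_second a b w0 h (d2 : fct2 R V -> R) :
  (forall x, 0 < a\@x /\ 0 < b\@x) -> ground_state e p a b w0 ->
  has_diff (fun z => dJ e p a b z h) w0 d2 -> dmass p w0 h = 0 -> 0 <= d2 h.
Proof.
move=> ab0 gs D m0.
set C := 2 / (p ^+ 2 * mass p w0).
apply: (@second_order_condition _ (fun s => J e p a b (w0 + s *: h))
  (fun s => dJ e p a b (w0 + s *: h) h)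
  (fun s => mass p (w0 + s *: h) - mass p w0) _ C).
- by move=> s; exact: has_diff_line (has_diff_J e p_gt4 a b (w0 + s *: h)).
- by rewrite scale0r addr0; exact: ground_state_critical.
- have D' : has_diff (fun z => dJ e p a b z h) (w0 + (0 : R) *: h) d2.
    by rewrite scale0r addr0.
  exact: has_diff_line D'.
- by rewrite scale0r addr0 subrr.
- have d2' := has_diff_line (has_diff_mass p_gt4 (w0 + (0 : R) *: h)).
  apply: is_derive_eq (is_deriveB d2' (is_derive_cst _ _ _)) _.
  by rewrite scale0r addr0 m0 subr0.
- by apply: filterS (ground_state_near h ab0 gs) => s; rewrite scale0r addr0.
Qed.

End Nehari.

(** * Strict positivity of ground states, and the dependence of the energy on the potential *)

Section Positivity.
Context (R : realType) (V : finType) (e : rel V) (p : R).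
Context (p_gt4 : 4 < p).
Implicit Types (a b u v : fct R V) (w k : fct2 R V) (x y z : V).

Definition vdelta x : fct R V := delta_mx (enum_rank x) ord0.

Lemma vdeltaE x y : (vdelta x)\@y = (y == x)%:R.
Proof. by rewrite /at_vertex mxE eqxx andbT (inj_eq enum_rank_inj). Qed.

Lemma spowR0 (r : R) : spowR r 0 = 0.
Proof. by rewrite /spowR sgr0 mul0r. Qed.

Lemma spowR_gt0 (r t : R) : 0 < t -> spowR r t = t `^ r.
Proof. by move=> t0; rewrite /spowR gtr0_sg// mul1r gtr0_norm. Qed.

Lemma spowR_ge0 (r t : R) : 0 <= t -> 0 <= spowR r t.
Proof. by move=> t0; rewrite mulr_ge0 ?sgr_ge0 ?powR_ge0. Qed.

(** Tested against the indicator of a zero [x] of [u >= 0], the potential term vanishes and every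
    gradient term is nonpositive, so each of them is 0. *)
Lemma dnormHp_vanish a u x : irreflexive e -> (forall y, 0 <= u\@y) ->
  u\@x = 0 -> dnormHp e p a u (vdelta x) = 0 -> forall y, e x y -> u\@y = 0.
Proof.
move=> irr u0 ux; rewrite /dnormHp.
have term_le0 z y : (u\@y - u\@z) * ((vdelta x)\@y - (vdelta x)\@z) <= 0.
  rewrite !vdeltaE; have := u0 y; have := u0 z.
  by case: eqP => [->|_]; case: eqP => [->|_]; rewrite ?ux ?mulr1n ?mulr0n; lra.
have dd_le0 z : ddirichlet e u (vdelta x) z <= 0.
  by apply: sumr_le0 => y _; exact: term_le0.
have pp2 : 0 < p / 2 by move: p_gt4; lra.
have sp_ge0 z : 0 <= p / 2 * spowR (p / 2 - 1) (dirichlet e u z).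
  by rewrite mulr_ge0 ?(ltW pp2)// spowR_ge0// dirichlet_ge0.
move=> S0.
have {S0} : \sum_z - (p / 2 * spowR (p / 2 - 1) (dirichlet e u z) *
                ddirichlet e u (vdelta x) z) = 0.
  rewrite -[RHS]oppr0 -[in RHS]S0 sumrN; congr (- _); apply: eq_bigr => z _.
  rewrite vdeltaE; case: eqP => [->|_]; last by rewrite !mulr0 addr0.
  by rewrite ux spowR0 !(mulr0, mul0r) addr0.
move=> /psumr_eq0P/(_ x isT) H.
have /eqP : - (p / 2 * spowR (p / 2 - 1) (dirichlet e u x) *
    ddirichlet e u (vdelta x) x) = 0.
  by apply: H => z _; rewrite oppr_ge0 mulr_ge0_le0.
rewrite oppr_eq0 mulf_eq0 [X in X || _]mulf_eq0 (gt_eqF pp2)/=.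
(* Either the gradient of [u] vanishes at [x], or the bilinear form at [x] does; the latter is minus
   the sum of the neighbouring values of [u]. Both make [u] vanish at the neighbours. *)
case/orP => [|/eqP dd0 y xy].
  rewrite /spowR mulf_eq0 sgr_eq0 powR_eq0 normr_eq0 => D0.
  have {D0} : dirichlet e u x == 0 by case/orP: D0 => [//|/andP[]].
  rewrite mulf_eq0 invr_eq0 pnatr_eq0/= => /eqP/psumr_eq0P D0 y xy.
  have /eqP := D0 (fun y _ => sqr_ge0 _) y xy.
  by rewrite sqrf_eq0 ux subr0 => /eqP.
have yx : (y == x) = false by apply/eqP => yx; move: xy; rewrite yx irr.
have : \sum_(y | e x y)
    - ((u\@y - u\@x) * ((vdelta x)\@y - (vdelta x)\@x)) = 0.
  by rewrite sumrN -/(ddirichlet e u (vdelta x) x) dd0 oppr0.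
move/psumr_eq0P => /(_ _ y xy); rewrite !vdeltaE eqxx yx ux => {}H.
suff : - ((u\@y - 0) * (0%:R - 1%:R)) = 0 by rewrite mulr0n mulr1n; lra.
apply: H => z _; rewrite oppr_ge0.
by have := term_le0 x z; rewrite ux (vdeltaE x x) eqxx.
Qed.

Lemma vanish_connected u x : connected_graph e -> u\@x = 0 ->
  (forall x, u\@x = 0 -> forall y, e x y -> u\@y = 0) -> forall y, u\@y = 0.
Proof.
move=> [_ _ con] ux step y; have /connectP[s] := con x y.
elim: s x ux {con} => [|z s IH] x ux /=; first by move=> _ ->.
by case/andP => xz zs yE; apply: (IH z) => //; exact: step ux _ xz.
Qed.

(** Where the first component is 0 the coupling has no first-order effect: both [dxlogx_sqr] and
    [spowR] vanish at 0. *)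
Lemma dJ_delta1 a b w x : w.1\@x = 0 ->
  dJ e p a b w (vdelta x, 0) = p^-1 * dnormHp e p a w.1 (vdelta x).
Proof.
move=> ux; rewrite /dJ /= [X in _ - _ * X]big1 ?mulr0 ?subr0 => [|y _].
  rewrite [X in _ + X]/dnormHp big1 ?addr0// => y _.
  rewrite at_vertex0 !mulr0 addr0 /ddirichlet big1 ?mulr0// => z _.
  by rewrite !at_vertex0 subr0 mulr0.
rewrite at_vertex0 vdeltaE /dlog_term /dxlogx_sqr.
by case: eqP => [->|_]; rewrite ?ux ?spowR0 !(mulr0, mul0r, addr0, add0r).
Qed.

Lemma dJ_delta2 a b w x : w.2\@x = 0 ->
  dJ e p a b w (0, vdelta x) = p^-1 * dnormHp e p b w.2 (vdelta x).
Proof.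
move=> ux; rewrite /dJ /= [X in _ - _ * X]big1 ?mulr0 ?subr0 => [|y _].
  rewrite [X in X + _]/dnormHp big1 ?add0r// => y _.
  rewrite at_vertex0 !mulr0 addr0 /ddirichlet big1 ?mulr0// => z _.
  by rewrite !at_vertex0 subr0 mulr0.
rewrite at_vertex0 vdeltaE /dlog_term /dxlogx_sqr.
by case: eqP => [->|_]; rewrite ?ux ?spowR0 !(mulr0, mul0r, addr0, add0r).
Qed.

(** A zero of one component spreads over the connected graph; once a component is identically 0,
    both summands of the mass are 0, against [nehari_mass_gt0]. *)
Lemma ground_state_gt0 a b w : connected_graph e ->
  (forall x, 0 < a\@x /\ 0 < b\@x) -> ground_state e p a b w ->
  positive_cone w -> forall x, 0 < w.1\@x /\ 0 < w.2\@x.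
Proof.
move=> graph_e ab0 gs w0 x; have [_ irr _] := graph_e.
have M0 := nehari_mass_gt0 p_gt4 ab0 gs.1.
have pn0 : p != 0 by rewrite gt_eqF//; move: p_gt4; lra.
have p2 : p - 2 != 0 by rewrite gt_eqF//; move: p_gt4; lra.
rewrite !lt_def (w0 x).1 (w0 x).2 !andbT; split; apply/eqP => wx.
- have u0 : forall y, w.1\@y = 0.
    apply: (vanish_connected _ wx) => // z uz.
    apply: (dnormHp_vanish (a := a) _ _ uz) => //.
      by move=> y; exact: (w0 y).1.
    apply: (mulfI (invr_neq0 pn0)); rewrite -(dJ_delta1 a b uz) mulr0.
    exact: ground_state_critical.
  move: M0; rewrite /mass big1 ?ltxx// => y _.
  by rewrite u0 normr0 powR0// expr0n/= mul0r mulr0 addr0.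
- have v0 : forall y, w.2\@y = 0.
    apply: (vanish_connected _ wx) => // z uz.
    apply: (dnormHp_vanish (a := b) _ _ uz) => //.
      by move=> y; exact: (w0 y).2.
    apply: (mulfI (invr_neq0 pn0)); rewrite -(dJ_delta2 a b uz) mulr0.
    exact: ground_state_critical.
  move: M0; rewrite /mass big1 ?ltxx// => y _.
  by rewrite v0 normr0 powR0// expr0n/= mul0r mulr0 addr0.
Qed.

(** Provides a direction, in the second component only, that is transversal to the tangent space;
    [UmatT_inj] uses it to correct vectors [(z, 0)]. *)
Lemma dmass_delta2_gt0 w x : (forall x, 0 < w.1\@x /\ 0 < w.2\@x) ->
  0 < dmass p w (0, vdelta x).
Proof.
move=> w0; rewrite /dmass (bigD1 x)//= big1 => [|y yx]; last first.
  by rewrite at_vertex0 vdeltaE (negbTE yx) /dmass_term !(mulr0, addr0).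
have [u0 v0] := w0 x.
rewrite addr0 at_vertex0 vdeltaE eqxx /dmass_term.
rewrite !mulr0 !mulr1 !addr0 mulr0 add0r.
have p2 : 0 < p - 2 by move: p_gt4; lra.
rewrite (spowR_gt0 _ v0) (gtr0_norm u0).
have u1 : 0 < w.1\@x ^+ 2 by rewrite exprn_gt0.
have [u2 v2] : 0 < w.1\@x `^ (p - 2) /\ 0 < w.2\@x `^ (p - 2 - 1).
  by rewrite !powR_gt0.
by rewrite addr_gt0// mulr_gt0// ?addr_gt0// mulr_gt0.
Qed.

(** The energy is affine in the potential, so along a branch the potential can be frozen at the
    expense of an explicit finite sum. *)
Lemma J_potential a a' b w : J e p a b w =
  J e p a' b w + \sum_x (a\@x - a'\@x) * (p^-1 * `|w.1\@x| `^ p).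
Proof.
rewrite /J; set B := p^-1 * \sum_x _; rewrite addrAC; congr (_ - _).
suff -> : normHp e p a w.1 = normHp e p a' w.1
    + \sum_x (a\@x - a'\@x) * `|w.1\@x| `^ p.
  rewrite !mulrDr -!addrA; congr (_ + _); rewrite addrC; congr (_ + _).
  by rewrite mulr_sumr; apply: eq_bigr => x _; rewrite mulrCA.
by rewrite -big_split; apply: eq_bigr => x _ /=; ring.
Qed.

Lemma dJ_potential a a' b w k : dJ e p a b w k =
  dJ e p a' b w k
  + \sum_x (a\@x - a'\@x) * (p^-1 * (p * spowR (p - 1) w.1\@x * k.1\@x)).
Proof.
rewrite /dJ; set B := p^-1 * \sum_x _; rewrite addrAC; congr (_ - _).
suff -> : dnormHp e p a w.1 k.1 = dnormHp e p a' w.1 k.1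
    + \sum_x (a\@x - a'\@x) * (p * spowR (p - 1) w.1\@x * k.1\@x).
  rewrite !mulrDr -!addrA; congr (_ + _); rewrite addrC; congr (_ + _).
  by rewrite mulr_sumr; apply: eq_bigr => x _; rewrite mulrCA.
by rewrite -big_split; apply: eq_bigr => x _ /=; ring.
Qed.

End Positivity.

(** * The Hessian on the tangent space *)

Section SecondVariation.
Context (R : realType) (V : finType) (e : rel V) (p : R) (p_gt4 : 4 < p).
Context (a b : fct R V) (w : fct2 R V).
Context (ab0 : forall x, 0 < a\@x /\ 0 < b\@x).
Context (gs : ground_state e p a b w).
Context (w0 : forall x, 0 < w.1\@x /\ 0 < w.2\@x).
Implicit Types (h k : fct2 R V) (x y : V).

Let M := mass p w.
Let M0 : 0 < M. Proof. exact: (nehari_mass_gt0 p_gt4 ab0 gs.1). Qed.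
Let p0 : 0 < p. Proof. by move: p_gt4; lra. Qed.

Lemma has_diff_lincomb (U : normedModType R) (F L : U -> R) z m
    (c : 'I_m -> R) (g : 'I_m -> U) : has_diff F z L ->
  L (\sum_i c i *: g i) = \sum_i c i * L (g i).
Proof.
case=> _ E; rewrite -E linear_sum; apply: eq_bigr => i _.
by rewrite linearZ -E.
Qed.

(** Since [G = p J - (2/p) mass] and [J' w = 0], the tangent space is the kernel of [mass' w]. *)
Lemma tangentP h : tangent e p a b w h <-> dmass p w h = 0.
Proof.
have D : has_diff (G e p a b) w
    (fun k => p * dJ e p a b w k + - (2 / p) * dmass p w k).
  have -> : G e p a b = (fun z => p * J e p a b z + - (2 / p) * mass p z).
    by apply/funext => z; rewrite GE// mulNr.
  exact: has_diffD (has_diffZ _ (has_diff_J _ _ _ _ _))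
                   (has_diffZ _ (has_diff_mass _ _)).
rewrite /tangent /= D.2 (ground_state_critical p_gt4 _ ab0 gs) mulr0 add0r.
split=> [/eqP|->]; last by rewrite mulr0.
rewrite mulf_eq0 oppr_eq0 mulf_eq0 invr_eq0 (gt_eqF p0) pnatr_eq0/=.
by move/eqP.
Qed.

Context (d2 : fct2 R V -> fct2 R V -> R).
Context (D2 : forall k, has_diff (fun z => dJ e p a b z k) w (d2 k)).
Context (d2C : forall h k, d2 h k = d2 k h).

(** The arguments swap because [d2 k] differentiates [dJ z k] with the test direction [k] held
    fixed. *)
Lemma d2JE h k : d2J e p a b w h k = d2 k h.
Proof.
rewrite /d2J -(D2 k).2.
congr ('d _ w h); apply/funext => z; exact: (has_diff_J e p_gt4 a b z).2.
Qed.

(** The Euler identity for [dJ], with its [p - 1] term removed by criticality. It makes [w]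
    orthogonal to the tangent space for the Hessian. *)
Lemma d2_radial k : d2 w k = - (2 / p) * dmass p w k.
Proof.
rewrite d2C (dJ_d2_self p_gt4 (D2 k)).
by rewrite (ground_state_critical p_gt4 _ ab0 gs) mulr0 sub0r mulNr.
Qed.

Lemma d2_tangent_ge0 h : tangent e p a b w h -> 0 <= d2 h h.
Proof.
move=> /tangentP; exact: (ground_state_second p_gt4 ab0 gs (D2 h)).
Qed.

Lemma dmass_w : dmass p w w = p * M.
Proof. exact: dmass_self. Qed.

Context (nondeg : nondegenerate_on_tangent e p a b w).

Lemma tangent0 : tangent e p a b w 0.
Proof.
apply/tangentP; rewrite -(scale0r 0).
by rewrite (has_diff_homogeneous 0 0 (has_diff_mass p_gt4 w)) mul0r.
Qed.

(** Both [h] and 0 represent the zero form on the tangent space, and representatives are unique. *)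
Lemma d2_nondeg h : tangent e p a b w h ->
  (forall k, tangent e p a b w k -> d2 k h = 0) -> h = 0.
Proof.
move=> Th h0.
have [h1 [_ U]] := nondeg (\0 : {scalar (fct2 R V)}).
have <- : h1 = h.
  apply: U; split; first exact: Th.
  move=> k Tk; apply: etrans (d2JE h k) _.
  exact: h0.
apply: U; split; first exact: tangent0.
move=> k Tk; apply: etrans (d2JE 0 k) _; rewrite -(scale0r 0).
by rewrite (has_diff_homogeneous 0 0 (D2 k)) mul0r.
Qed.

Section Basis.
Context (m : nat) (f : 'I_m -> fct2 R V).
Context (f_onb : orthonormal_basis (tangent e p a b w) f).
Implicit Type (c : 'cV[R]_m).

Let H := Hmat e p a b w f.
Let U := Umat f.

Definition lincomb c : fct2 R V := \sum_i c i ord0 *: f i.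

Lemma dotHDl h h' k : dotH (h + h') k = dotH h k + dotH h' k.
Proof.
rewrite /dotH [in RHS]addrACA; congr (_ + _); rewrite -big_split;
  by apply: eq_bigr => x _ /=; rewrite at_vertexD mulrDl.
Qed.

Lemma dotHZl (s : R) h k : dotH (s *: h) k = s * dotH h k.
Proof.
rewrite /dotH mulrDr !mulr_sumr; congr (_ + _); apply: eq_bigr => x _ /=;
  by rewrite at_vertexZ mulrA.
Qed.

Lemma dotH_lincomb c k : dotH (lincomb c) k = \sum_i c i ord0 * dotH (f i) k.
Proof.
rewrite /lincomb; elim/big_rec2: _ => [|i s t _ <-].
  by rewrite -(scale0r 0) dotHZl mul0r.
by rewrite dotHDl dotHZl.
Qed.

Lemma lincomb_inj0 c : lincomb c = 0 -> c = 0.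
Proof.
have [_ onb _] := f_onb.
move=> c0; apply/matrixP => i j; rewrite ord1 mxE.
have : dotH (lincomb c) (f i) = 0 by rewrite c0 -(scale0r 0) dotHZl mul0r.
rewrite dotH_lincomb (bigD1 i)//= onb eqxx mulr1 big1 ?addr0// => l li.
by rewrite onb (negbTE li) mulr0.
Qed.

Lemma tangent_lincomb c : tangent e p a b w (lincomb c).
Proof.
have [Tf _ _] := f_onb; apply/tangentP.
rewrite (has_diff_lincomb _ _ (has_diff_mass p_gt4 w)) big1// => i _.
by have /tangentP -> := Tf i; rewrite mulr0.
Qed.

Lemma lincomb_surj h : tangent e p a b w h -> exists c, h = lincomb c.
Proof.
have [_ _ span] := f_onb; move=> /span[c ->].
by exists (\col_i c i); apply: eq_bigr => i _; rewrite mxE.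
Qed.

Lemma d2_lincomb k c : d2 k (lincomb c) = \sum_i c i ord0 * d2 k (f i).
Proof. exact: has_diff_lincomb (D2 k). Qed.

Lemma HmatE i j : H i j = d2 (f i) (f j).
Proof. by rewrite mxE d2JE. Qed.

Lemma Hmat_mul c i : (H *m c) i ord0 = d2 (f i) (lincomb c).
Proof.
by rewrite mxE d2_lincomb; apply: eq_bigr => j _; rewrite HmatE mulrC.
Qed.

Lemma Hmat_sym : H^T = H.
Proof. by apply/matrixP => i j; rewrite mxE !HmatE d2C. Qed.

Lemma Hmat_inj c : H *m c = 0 -> c = 0.
Proof.
move=> Hc; apply: lincomb_inj0; apply: d2_nondeg; first exact: tangent_lincomb.
move=> k /lincomb_surj[c' ->]; rewrite d2C d2_lincomb big1// => i _.
by rewrite d2C -Hmat_mul Hc mxE mulr0.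
Qed.

Lemma Hmat_unit : H \in unitmx.
Proof.
rewrite unitmxE unitfE; apply/det0P => -[v v0 vH].
move/eqP: v0; apply; apply: trmx_inj; rewrite trmx0; apply: Hmat_inj.
by rewrite -Hmat_sym -trmx_mul vH trmx0.
Qed.

Lemma Hmat_quad c : (c^T *m H *m c) ord0 ord0 = d2 (lincomb c) (lincomb c).
Proof.
rewrite -mulmxA mxE d2_lincomb.
by apply: eq_bigr => i _; rewrite mxE Hmat_mul d2C.
Qed.

(** The Hessian is nonnegative on the tangent space, and a null vector of a nonnegative symmetric
    form lies in its radical, which is trivial by [d2_nondeg]. *)
Lemma Hmat_posdef c : c != 0 -> 0 < (c^T *m H *m c) ord0 ord0.
Proof.
move=> c0; rewrite Hmat_quad lt_def d2_tangent_ge0 ?andbT; last first.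
  exact: tangent_lincomb.
apply: contra c0 => /eqP q0; apply/eqP/lincomb_inj0.
set t := lincomb c in q0 *.
apply: d2_nondeg; first exact: tangent_lincomb.
move=> k Tk.
have q s : 0 <= 2 * s * d2 k t + s ^+ 2 * d2 k k.
  have Tks : tangent e p a b w (t + s *: k).
    apply/tangentP; rewrite (has_diff_additive _ _ (has_diff_mass p_gt4 w)).
    rewrite (has_diff_homogeneous _ _ (has_diff_mass p_gt4 w)).
    have /tangentP -> := Tk; have /tangentP -> := tangent_lincomb c.
    by rewrite mulr0 addr0.
  have := d2_tangent_ge0 Tks.
  rewrite (has_diff_additive _ _ (D2 _)) (has_diff_homogeneous _ _ (D2 _)).
  rewrite (d2C _ t) (d2C _ k).
  rewrite !(has_diff_additive _ _ (D2 _)) !(has_diff_homogeneous _ _ (D2 _)).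
  by rewrite q0 (d2C t k); congr (_ <= _); ring.
apply/eqP/negPn/negP => B0.
have Q0 := d2_tangent_ge0 Tk.
have Q1 : 0 < d2 k k + 1 by rewrite ltr_wpDl.
(* A nearly optimal step: with [d2 k k + 1] in place of [d2 k k] the denominator is positive even if
   [k] is null, and the value stays negative. *)
have := q (- d2 k t / (d2 k k + 1)).
have -> : 2 * (- d2 k t / (d2 k k + 1)) * d2 k t +
   (- d2 k t / (d2 k k + 1)) ^+ 2 * d2 k k =
   - (d2 k t / (d2 k k + 1)) ^+ 2 * (d2 k k + 2).
  by field; rewrite gt_eqF.
rewrite mulNr oppr_ge0 leNgt mulr_gt0//; last by move: Q0; lra.
by rewrite exprn_even_gt0//= mulf_neq0// invr_neq0// gt_eqF.
Qed.

Lemma UmatT_mul (z : 'cV[R]_#|V|) i : (U^T *m z) i ord0 = dotH (f i) (z, 0).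
Proof.
rewrite mxE /dotH [X in _ + X]big1 ?addr0 => [|x _]; last first.
  by rewrite /= at_vertex0 mulr0.
rewrite (reindex enum_rank) /=; last exact: onW_bij (enum_rank_bij V).
by apply: eq_bigr => x _; rewrite !mxE.
Qed.

(** The tangent space projects onto the first factor: some tangent [h] has first component [z].
    Orthogonality of [(z, 0)] to the basis then gives [|z|^2 = dotH h (z, 0) = 0]. *)
Lemma UmatT_inj (z : 'cV[R]_#|V|) : U^T *m z = 0 -> z = 0.
Proof.
move=> Uz; apply/matrixP => i j; rewrite ord1 mxE {j}.
(* The index [i] of the entry under study supplies the vertex at which the correction is made. *)
have V0 := dmass_delta2_gt0 p_gt4 (enum_val i) w0.
set dv := dmass p w (0, _) in V0.
pose s := - dmass p w (z, 0) / dv.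
pose h : fct2 R V := (z, 0) + s *: (0, vdelta R (enum_val i)).
have Th : tangent e p a b w h.
  apply/tangentP; rewrite (has_diff_additive _ _ (has_diff_mass p_gt4 w)).
  rewrite (has_diff_homogeneous _ _ (has_diff_mass p_gt4 w)) -/dv.
  by rewrite /s; field; rewrite gt_eqF.
have : dotH h (z, 0) = 0.
  have [c ->] := lincomb_surj Th; rewrite dotH_lincomb big1// => l _.
  by rewrite -UmatT_mul Uz mxE mulr0.
rewrite /dotH [X in _ + X]big1 ?addr0 => [|x _]; last first.
  by rewrite /= at_vertex0 mulr0.
have -> : h.1 = z by rewrite /h /= scaler0 addr0.
move/psumr_eq0P => /(_ (fun x _ => sqr_ge0 _))/(_ (enum_val i) isT)/eqP.
by rewrite mulf_eq0 orbb /at_vertex enum_valK => /eqP.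
Qed.

(** The quadratic form at [z] equals that of [H] at [y = H^-1 U^T z], and [y = 0] forces
    [U^T z = 0]. *)
Lemma Heff_sym_posdef : sym_posdef (Heff e p a b w f).
Proof.
rewrite /Heff -/H -/U; split.
  by rewrite !trmx_mul trmxK trmx_inv Hmat_sym mulmxA.
move=> z z0; pose y := invmx H *m (U^T *m z).
have Hy : H *m y = U^T *m z by rewrite mulKVmx// Hmat_unit.
have -> : z^T *m (U *m invmx H *m U^T) *m z = y^T *m H *m y.
  rewrite -[y^T *m H *m y]mulmxA Hy /y !trmx_mul trmxK trmx_inv Hmat_sym.
  by rewrite !mulmxA.
apply: Hmat_posdef; apply: contra z0 => /eqP y0; apply/eqP/UmatT_inj.
by rewrite -Hy y0 mulmx0.
Qed.

(* Differentiating the Euler-Lagrange equation along the branch determines the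
   derivative [t] of the branch: its tangential part through the Hessian on
   the tangent space, its radial part by testing against [w] itself. *)
Lemma branch_derivative (h : fct R V) (t : fct2 R V) :
  (forall k, d2 k t = - \sum_x h\@x * (w.1\@x `^ (p - 1) * k.1\@x)) ->
  t.1 = - (Heff e p a b w f *m (diag_mx (powcol w.1 (p - 1))^T *m h))
        + ((2 * M)^-1 * \sum_x h\@x * w.1\@x `^ p) *: w.1.
Proof.
move=> tE; set D := diag_mx _; set c := (2 * M)^-1 * _.
(* As [dmass w w = p * M], this identity says that [t - c *: w] is tangent. It comes from testing
   [tE] with [k = w] and using [d2_radial]. *)
have cE : dmass p w t = c * (p * M).
  have : d2 w t = - \sum_x h\@x * w.1\@x `^ p.
    rewrite tE; congr (- _); apply: eq_bigr => x _.
    rewrite mulrC [in RHS]mulrC; congr (_ * _).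
    by rewrite mulrC mulr_powRB1// ltW// (w0 x).1.
  rewrite d2_radial => E; rewrite /c.
  have -> : \sum_x h\@x * w.1\@x `^ p = 2 / p * dmass p w t.
    by rewrite -[LHS]opprK -E mulNr opprK.
  by field; rewrite !gt_eqF.
have [y yE] : exists y : 'cV[R]_m, t - c *: w = lincomb y.
  apply: lincomb_surj; apply/tangentP.
  rewrite -scaleNr (has_diff_additive _ _ (has_diff_mass p_gt4 w)).
  rewrite (has_diff_homogeneous _ _ (has_diff_mass p_gt4 w)) dmass_w cE.
  by rewrite mulNr subrr.
(* Testing with the basis vector [f i] eliminates the radial part, because [d2 (f i) w] is a
   multiple of [dmass w (f i) = 0]. *)
have Hy : H *m y = - (U^T *m (D *m h)).
  apply/matrixP => i j; rewrite ord1 Hmat_mul -yE -scaleNr.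
  rewrite (has_diff_additive _ _ (D2 _)) (has_diff_homogeneous _ _ (D2 _)).
  have [Tf _ _] := f_onb.
  rewrite (d2C _ w) d2_radial; have /tangentP -> := Tf i.
  rewrite !mulr0 addr0 tE [in RHS]mxE UmatT_mul; congr (- _).
  rewrite /dotH [X in _ = _ + X]big1 ?addr0 => [|x _]; last first.
    by rewrite /= at_vertex0 mulr0.
  apply: eq_bigr => x _ /=.
  by rewrite /D mul_diag_mx /at_vertex !mxE; ring.
have {}Hy : y = - (invmx H *m (U^T *m (D *m h))).
  by rewrite -mulmxN -Hy mulKmx// Hmat_unit.
have -> : t = lincomb y + c *: w by rewrite -yE subrK.
rewrite /Heff -/H -/U -!mulmxA -mulmxN -Hy; congr (_ + _).
apply/matrixP => i j; rewrite ord1 mxE.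
rewrite /lincomb (big_morph (fun h : fct2 R V => h.1 i ord0)
  (id1 := 0) (op1 := +%R)).
- by apply: eq_bigr => l _; rewrite !mxE mulrC.
- by move=> h1 h2; rewrite mxE.
- by rewrite mxE.
Qed.

End Basis.
End SecondVariation.

(** * The branch of ground states *)

Section Branch.
Context (R : realType) (V : finType) (e : rel V) (p : R) (p_gt4 : 4 < p).
Implicit Types (a b h : fct R V) (z k : fct2 R V) (x y : V).

(** The partial derivative of [J] with respect to the value of the first potential at [x]. *)
Definition potential x z : R := p^-1 * `|z.1\@x| `^ p.

Definition dpotential x z k : R := p^-1 * (p * spowR (p - 1) z.1\@x * k.1\@x).

Lemma twice_diff_at_potential x z :
  twice_diff_at (potential x) (dpotential x) z.
Proof.
apply: twice_diff_atZ; apply: twice_diff_at_powR_norm.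
  by move: p_gt4; lra.
exact: (twice_diff_at_vertex (@linear_fst R V) (@continuous_fst' R V)).
Qed.

Lemma has_diff_vertex x a : has_diff (fun a => a\@x) a (fun h => h\@x).
Proof.
have cid : continuous (id : fct R V -> fct R V) by move=> ?; exact: cvg_id.
have lid : linear (id : fct R V -> fct R V) by [].
exact: (twice_diff_at_vertex lid cid x a).1.
Qed.

Lemma has_diff_vertexB x a c : has_diff (fun a => a\@x - c) a (fun h => h\@x).
Proof.
apply: has_diff_ext (has_diffD (has_diff_vertex x a) (has_diff_cst _ _)) => h.
exact: addr0.
Qed.

Context (b : fct R V) (w : fct R V -> fct2 R V).

(** The envelope principle: with the potential frozen at [a], criticality removes the motion of [w],
    and in the remaining sum only the factor [a' - a], zero at [a], contributes. *)
Lemma has_diff_energy a : differentiable w a ->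
  (forall k, dJ e p a b (w a) k = 0) ->
  has_diff (fun a => J e p a b (w a)) a
    (fun h => \sum_x h\@x * potential x (w a)).
Proof.
move=> wd crit.
have -> : (fun a => J e p a b (w a)) = (fun a' => J e p a b (w a')
    + \sum_x (a'\@x - a\@x) * potential x (w a')).
  by apply/funext => a'; exact: J_potential.
have D1 := has_diff_comp wd (has_diff_J e p_gt4 a b (w a)).
have D x := has_diffM (has_diff_vertexB x a a\@x)
  (has_diff_comp wd ((twice_diff_at_potential x (w a)).1 (w a))).
have D3 := has_diff_sum (index_enum V) (P := xpredT) (fun x _ => D x).
apply: has_diff_ext (has_diffD D1 D3) => h.
rewrite crit add0r; apply: eq_bigr => x _.
by rewrite subrr mul0r add0r mulrC.
Qed.

(** Implicit differentiation of the Euler-Lagrange equation tested with a fixed [k]; the equation is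
    available on a neighbourhood of [a]. *)
Lemma has_diff_critical a (d2 : fct2 R V -> R) k : differentiable w a ->
  has_diff (fun z => dJ e p a b z k) (w a) d2 ->
  (\forall a' \near a, dJ e p a' b (w a') k = 0) ->
  forall h, d2 ('d w a h) = - \sum_x h\@x * dpotential x (w a) k.
Proof.
move=> wd D2 crit h.
have D1 := has_diff_comp wd D2.
(* Only the existence of these differentials matters: in the product rule they are multiplied by
   [a - a = 0]. *)
have [Pd Pd2] : exists L : V -> fct2 R V -> R,
    forall x, has_diff (fun z => dpotential x z k) (w a) (L x).
  have H x : exists L, has_diff (fun z => dpotential x z k) (w a) L.
    have [_ [L HL _]] := twice_diff_at_potential x (w a).
    by exists (L k).
  by have [L HL] := choice H; exists L.
have D x := has_diffM (has_diff_vertexB x a a\@x) (has_diff_comp wd (Pd2 x)).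
have D3 := has_diffD D1
  (has_diff_sum (index_enum V) (P := xpredT) (fun x _ => D x)).
have Z : has_diff (fun a' => dJ e p a b (w a') k +
    \sum_x (a'\@x - a\@x) * dpotential x (w a') k) a (fun=> 0).
  apply: near_has_diff (has_diff_cst 0 a).
  apply: filterS crit => a' E; apply: etrans (esym E) _.
  exact: dJ_potential.
have /eqP := has_diff_uniq h D3 Z.
rewrite addr_eq0 => /eqP ->; congr (- _); apply: eq_bigr => x _.
by rewrite subrr mul0r add0r mulrC.
Qed.

End Branch.

Lemma near_vertex_gt0 (R : realType) (V : finType) (a : fct R V) :
  (forall x, 0 < a\@x) -> \forall a' \near a, forall x, 0 < a'\@x.
Proof.
move=> a0.
apply: (@filter_forall _ _ (fun x (a : fct R V) => 0 < a\@x) (nbhs a) _) => x.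
have c : {for a, continuous (fun a : fct R V => a\@x)}.
  exact: differentiable_continuous (has_diff_vertex x a).1.
exact: (cvgr_gt _ c).
Qed.

Lemma near_open (T : topologicalType) (A : set T) (x : T) : open A -> A x ->
  \forall y \near x, A y.
Proof. by move=> oA Ax; exact: open_nbhs_nbhs. Qed.

Theorem theorem1p5 (R : realType) (V : finType) (e : rel V) (p : R)
    (a0 b0 u0 v0 : fct R V) (O : set (fct R V)) (w : fct R V -> fct2 R V)
    (graph_e : connected_graph e) (p_gt4 : 4 < p)
    (A1 : assumption_A1 a0 b0) (A2 : assumption_A2' a0 b0)
    (gs0 : ground_state e p a0 b0 (u0, v0))
    (cone0 : positive_cone (u0, v0))
    (nondeg0 : nondegenerate_on_tangent e p a0 b0 (u0, v0))
    (open_O : open O) (O_a0 : O a0)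
    (branch : ground_state_branch e p O b0 w)
    (w_a0 : w a0 = (u0, v0)) :
  let Phi (a : fct R V) : R := - J e p a b0 (w a) in
  let M : R := mass p (u0, v0) in
  let W : 'M[R]_#|V| := diag_mx (powcol u0 (p - 1))^T in
  [/\ 0 < M,
      twice_differentiable Phi a0
    & forall f : 'I_((2 * #|V|).-1) -> fct2 R V,
        orthonormal_basis (tangent e p a0 b0 (u0, v0)) f ->
        sym_posdef (Heff e p a0 b0 (u0, v0) f) /\
        hessian Phi a0 =
          W *m Heff e p a0 b0 (u0, v0) f *m W
          - (2 * M)^-1 *: (powcol u0 p *m (powcol u0 p)^T)].
Proof.
move=> Phi M W.
have ab0 x : 0 < a0\@x /\ 0 < b0\@x.
  have [V0 V0_gt0 /(_ x)[aV bV]] := A1.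
  by split; [exact: lt_le_trans aV | exact: lt_le_trans bV].
have uv0 := ground_state_gt0 p_gt4 graph_e ab0 gs0 cone0.
have M0 : 0 < M by exact: (nehari_mass_gt0 p_gt4 ab0 gs0.1).
have [wd _ wgs] := branch.
have near_O : \forall a \near a0, O a by exact: near_open.
have near_pos : \forall a \near a0, forall x, 0 < a\@x.
  by apply: near_vertex_gt0 => x; exact: (ab0 x).1.
have near_crit : \forall a \near a0, forall k, dJ e p a b0 (w a) k = 0.
  near=> a => k.
  have Oa : O a by near: a.
  have a_pos : forall x, 0 < a\@x by near: a.
  have ab x : 0 < a\@x /\ 0 < b0\@x by split; [exact: a_pos | exact: (ab0 x).2].
  exact: (ground_state_critical p_gt4 k ab (wgs a Oa).1).
have near_diff : \forall a \near a0,
    has_diff Phi a (fun h => - \sum_x h\@x * potential p x (w a)).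
  near=> a.
  have Oa : O a by near: a.
  have crit : forall k, dJ e p a b0 (w a) k = 0 by near: a.
  have := has_diffZ (-1) (has_diff_energy p_gt4 (wd a Oa) crit).
  rewrite /Phi; under eq_fun do rewrite mulN1r.
  by apply: has_diff_ext => h; rewrite mulN1r.
(* An explicit formula for the gradient, which agrees with [gradient Phi] only near [a0]. As a sum
   of scalar functions times basis vectors, its differentiability reduces to that of its
   coordinates. *)
pose grad (a : fct R V) : fct R V :=
  \sum_i (- potential p (enum_val i) (w a)) *: delta_mx i ord0.
have gradE a i : (grad a) i ord0 = - potential p (enum_val i) (w a).
  rewrite /grad summxE (bigD1 i)//= big1 => [|j ji]; rewrite !mxE.
    by rewrite !eqxx mulr1 addr0.
  by rewrite eq_sym (negbTE ji) mulr0.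
have near_grad : \forall a \near a0, grad a = gradient Phi a.
  near=> a.
  have D : has_diff Phi a (fun h => - \sum_x h\@x * potential p x (w a)).
    by near: a.
  apply/matrixP => i j; rewrite ord1 gradE mxE.
  have [_ ->] := has_diff_is_derive (delta_mx i ord0) D.
  congr (- _); rewrite (bigD1 (enum_val i))//= big1 => [|x xi].
    by rewrite /at_vertex mxE enum_valK !eqxx mul1r addr0.
  rewrite /at_vertex mxE (can2_eq enum_rankK enum_valK) (negbTE xi) mul0r.
  by [].
have potd x : has_diff (fun a => - potential p x (w a)) a0
    (fun h => - dpotential p x (u0, v0) ('d w a0 h)).
  have := has_diffZ (-1)
    (has_diff_comp (wd _ O_a0)
      ((twice_diff_at_potential p_gt4 x (w a0)).1 (w a0))).
  rewrite w_a0; under eq_fun do rewrite mulN1r.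
  by apply: has_diff_ext => h; rewrite mulN1r.
have grad_d : differentiable grad a0.
  have -> : grad = \sum_i (fun a => (- potential p (enum_val i) (w a)) *:
      (delta_mx i ord0 : fct R V)).
    by apply/funext => a; rewrite fct_sumE.
  apply: differentiable_sum => i; apply: differentiableZl.
  exact: (potd (enum_val i)).1.
have [grad_d' grad_dE] := near_differentiable near_grad grad_d.
split=> //.
  by split=> //; apply: filterS near_diff => a [].
move=> f f_onb.
have [_ [d2 D2 d2C]] := twice_diff_at_J e p_gt4 a0 b0 uv0.
split.
  exact: (Heff_sym_posdef p_gt4 ab0 gs0 uv0 D2 d2C nondeg0 f_onb).
(* The differentiated Euler-Lagrange equation is precisely the hypothesis of [branch_derivative],
   once [spowR] is an ordinary power by positivity. *)
have dw h : ('d w a0 h).1 =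
    - (Heff e p a0 b0 (u0, v0) f *m (W *m h))
    + ((2 * M)^-1 * \sum_x h\@x * u0\@x `^ p) *: u0.
  apply: (branch_derivative p_gt4 ab0 gs0 uv0 D2 d2C nondeg0 f_onb) => k.
  have D2k : has_diff (fun z => dJ e p a0 b0 z k) (w a0) (d2 k).
    by rewrite w_a0.
  have crit : \forall a \near a0, dJ e p a b0 (w a) k = 0.
    by apply: filterS near_crit => a; exact.
  rewrite (has_diff_critical p_gt4 (wd _ O_a0) D2k crit h).
  congr (- _); apply: eq_bigr => x _; congr (_ * _).
  rewrite /dpotential w_a0 spowR_gt0 ?(uv0 x).1// !mulrA mulVf ?mul1r//.
  by rewrite gt_eqF//; move: p_gt4; lra.
apply/matrixP => i j; rewrite mxE.
have -> : ('D_(delta_mx j ord0) (gradient Phi) a0) i ord0 =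
    - dpotential p (enum_val i) (u0, v0) ('d w a0 (delta_mx j ord0)).
  rewrite -(near_eq_derive _ near_grad) derive_mx; last exact: diff_derivable.
  rewrite mxE.
  under [X in 'D__ X _]eq_fun do rewrite gradE.
  by have [_ ->] := has_diff_is_derive (delta_mx j ord0) (potd (enum_val i)).
rewrite /dpotential /= spowR_gt0 ?(uv0 _).1// dw.
have uE l : u0\@(enum_val l) = u0 l ord0 by rewrite /at_vertex enum_valK.
have sumE : \sum_x (delta_mx j ord0 : fct R V)\@x * u0\@x `^ p = u0 j ord0 `^ p.
  rewrite (bigD1 (enum_val j))//= big1 => [|x xj].
    by rewrite uE /at_vertex mxE enum_valK !eqxx mul1r addr0.
  by rewrite /at_vertex mxE (can2_eq enum_rankK enum_valK) (negbTE xj) mul0r.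
rewrite sumE at_vertexD at_vertexZ !uE.
have pn0 : p != 0 by rewrite gt_eqF//; move: p_gt4; lra.
have u_gt0 : 0 < u0 i ord0 by rewrite -uE; exact: (uv0 _).1.
(* The prefactor [u0 i ^ (p - 1)] from differentiating the power combines with the radial part
   [u0 i] of the branch derivative into [u0 i ^ p], which gives the rank-one term. *)
have upE : u0 i ord0 `^ p = u0 i ord0 * u0 i ord0 `^ (p - 1).
  by rewrite mulr_powRB1// ?ltW//; move: p_gt4; lra.
have -> : (- (Heff e p a0 b0 (u0, v0) f
        *m (W *m delta_mx j ord0)))\@(enum_val i) =
    - (Heff e p a0 b0 (u0, v0) f i j * u0 j ord0 `^ (p - 1)).
  rewrite /at_vertex enum_valK mxE; congr (- _).
  rewrite mulmxA -colE mxE /W mul_mx_diag !mxE.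
  by [].
have -> : (W *m Heff e p a0 b0 (u0, v0) f *m W
      - (2 * M)^-1 *: (powcol u0 p *m (powcol u0 p)^T)) i j =
    u0 i ord0 `^ (p - 1) * Heff e p a0 b0 (u0, v0) f i j * u0 j ord0 `^ (p - 1)
    - (2 * M)^-1 * (u0 i ord0 `^ p * u0 j ord0 `^ p).
  rewrite mxE; congr (_ + _).
    by rewrite /W mul_mx_diag mul_diag_mx !mxE.
  by rewrite mxE; congr (- _); rewrite mxE mxE big_ord1 !mxE.
rewrite upE; field.
by rewrite pn0 gt_eqF.
Unshelve. all: by end_near. Qed.
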